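(* Let $X$ be a normed linear space and $Y$ a Banach space such that the pair $(X,Y)$ has properties (LE) and (LA$_1$). Let $\Omega\subset X$ be an open set and let $A\subset\Omega$ be relatively closed (in $\Omega$). Suppose that $f\colon A\to Y$ satisfies condition (W) with $G\colon A\to\mathcal L(X;Y)$. Then $f$ can be extended to a mapping $g\in C^1(\Omega;Y)$ such that $Dg=G$ on $A$.
   Context: All normed linear spaces are real. $U(x,r)$ is the open ball with centre $x$ and radius $r$, $U_X$ is the open unit ball of $X$. An $L$-Lipschitz mapping is a mapping with a (not necessarily minimal) Lipschitz constant $L$. $\mathcal L(X;Y)$ is the normed space of continuous linear operators from $X$ to $Y$. $Dg$ is the Fréchet derivative. For open $\Omega\subset X$, $C^k(\Omega;Y)$ is the space of $C^k$-smooth (in the Fréchet sense) mappings from $\Omega$ to $Y$. Condition (W): a mapping $f\colon A\to Y$, $A\subset X$, satisfies condition (W) with $G$ if $G\colon A\to\mathcal L(X;Y)$ is continuous and for each $x\in A$ the operator $G(x)$ is a strict derivative of $f$ at $x$ with respect to $A$, i.e. for each $\varepsilon>0$ there is $\delta>0$ such that $\|f(z)-f(y)-G(x)[z-y]\|\le\varepsilon\|z-y\|$ whenever $y,z\in U(x,\delta)\cap A$. Property (LE): the pair $(X,Y)$ of normed linear spaces has property (LE) if there is $C>0$ such that for every $A\subset X$ every $L$-Lipschitz mapping $f\colon A\to Y$ has a $CL$-Lipschitz extension to the whole of $X$. Property (LA$_k$), $k\in\mathbb N\cup\{\infty\}$: the pair $(X,Y)$ of normed linear spaces has property (LA$_k$)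 if there is $C\ge0$ such that for any $L$-Lipschitz mapping $f\colon U_X\to Y$ and any $\varepsilon>0$ there is a $CL$-Lipschitz mapping $g\in C^k(U_X;Y)$ such that $\sup_{U_X}\|f-g\|\le\varepsilon$. *)

(* Defs.v *)
From HB Require Import structures.
From mathcomp Require Import all_boot all_order all_algebra.
From mathcomp Require Import all_classical all_reals all_analysis.

Set Implicit Arguments.
Unset Strict Implicit.
Unset Printing Implicit Defensive.

Import Order.TTheory GRing.Theory Num.Theory.
Import numFieldNormedType.Exports.

Local Open Scope classical_set_scope.
Local Open Scope ring_scope.

(** [lcfun X Y] is the space L(X;Y) of continuous linear operators, equipped
    below with the operator norm as a [normedModType]. *)
Section ContinuousLinearOperators.
Context {R : realType} (X Y : normedModType R).

Definition lcfun_pred : {pred X -> Y} :=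
  mem [set f : X -> Y | linear f /\ continuous f].

Record lcfun := LCFun { lcfun_val :> X -> Y ; _ : lcfun_val \in lcfun_pred }.

HB.instance Definition _ := [isSub for lcfun_val].
HB.instance Definition _ := [Choice of lcfun by <:].

Lemma lcfun_linear (f : lcfun) : linear f.
Proof. by have := valP f; rewrite inE => -[]. Qed.

Lemma lcfun_continuous (f : lcfun) : continuous f.
Proof. by have := valP f; rewrite inE => -[]. Qed.

HB.instance Definition _ (f : lcfun) :=
  GRing.isLinear.Build R X Y *:%R (lcfun_val f) (lcfun_linear f).

Lemma lcfun_submod_closed : submod_closed lcfun_pred.
Proof.
split.
  rewrite inE; split; first by move=> a u v; rewrite /= scaler0 addr0.
  exact: cst_continuous.
move=> a f g; rewrite !inE => -[fl fc] [gl gc]; split.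
  have E w : (a *: f + g) w = a *: f w + g w by [].
  move=> b u v; rewrite !E fl gl !scalerDr !scalerA mulrC -!addrA.
  by congr (_ + _); rewrite addrCA.
move=> x; apply: (@cvgD _ _ _ _ _ (fun y => a *: f y) g).
  by apply: cvgZr; exact: fc.
exact: gc.
Qed.

HB.instance Definition _ :=
  GRing.isSubmodClosed.Build R (X -> Y) lcfun_pred lcfun_submod_closed.
HB.instance Definition _ := [SubChoice_isSubLmodule of lcfun by <:].

Definition opnorm (f : lcfun) : R := sup [set `|f x| | x in [set x | `|x| <= 1]].

Lemma lcfun_unit_ball_has_sup (f : lcfun) :
  has_sup [set `|f x| | x in [set x | `|x| <= 1]].
Proof.
split; first by exists `|f 0|, 0 => //=; rewrite normr0.
have /(_ 0)/continuous_linear_bounded := @lcfun_continuous f.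
move=> /(_ 0)/bounded_funP/(_ 1)[M fM].
by exists M => _ [x /= x1 <-]; exact: fM.
Qed.

Lemma opnorm_ub (f : lcfun) x : `|x| <= 1 -> `|f x| <= opnorm f.
Proof.
move=> x1; apply: sup_upper_bound; first exact: lcfun_unit_ball_has_sup.
by exists x.
Qed.

Lemma opnorm_lub (f : lcfun) M :
  (forall x, `|x| <= 1 -> `|f x| <= M) -> opnorm f <= M.
Proof.
move=> fM; apply: ge_sup; first by case: (lcfun_unit_ball_has_sup f).
by move=> _ [x /= x1 <-]; exact: fM.
Qed.

Lemma opnorm_ge0 f : 0 <= opnorm f.
Proof. by apply: le_trans (@opnorm_ub f 0 _); rewrite ?normr0. Qed.

Lemma le_opnorm (f : lcfun) x : `|f x| <= opnorm f * `|x|.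
Proof.
have [->|x0] := eqVneq x 0; first by rewrite linear0 !normr0 mulr0.
have xgt0 : 0 < `|x| by rewrite normr_gt0.
have := @opnorm_ub f (`|x|^-1 *: x).
rewrite linearZ/= !normrZ normfV normr_id mulVf ?gt_eqF// lexx => /(_ isT).
by rewrite ler_pdivrMl// mulrC.
Qed.

Lemma opnormD (f g : lcfun) : opnorm (f + g) <= opnorm f + opnorm g.
Proof.
apply: opnorm_lub => x x1; apply: le_trans (ler_normD _ _) _.
by rewrite lerD ?opnorm_ub.
Qed.

Lemma opnormZ (a : R) (f : lcfun) : opnorm (a *: f) = `|a| * opnorm f.
Proof.
have le b (h : lcfun) : opnorm (b *: h) <= `|b| * opnorm h.
  apply: opnorm_lub => x x1; rewrite [X in `|X|]/(b *: h x) normrZ.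
  by rewrite ler_wpM2l ?opnorm_ub.
apply/eqP; rewrite eq_le le /=.
have [->|a0] := eqVneq a 0; first by rewrite normr0 mul0r opnorm_ge0.
rewrite -ler_pdivlMl ?normr_gt0// -normfV.
by have := le a^-1 (a *: f); rewrite scalerA mulVf// scale1r.
Qed.

Lemma opnorm_eq0 (f : lcfun) : opnorm f = 0 -> f = 0.
Proof.
move=> f0; apply/val_inj/funext => x /=; apply/eqP.
by rewrite -normr_le0 (le_trans (le_opnorm f x))// f0 mul0r.
Qed.

HB.instance Definition _ :=
  Lmodule_isNormed.Build R lcfun opnormD opnormZ opnorm_eq0.

End ContinuousLinearOperators.

(** Mappings defined on a subset [A] of [X] are represented by total functions
    whose values outside [A] are irrelevant. *)
Section Definitions.
Context {R : realType} (X Y : normedModType R).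

Definition strict_derivative_wrt (A : set X) (f : X -> Y) (x : X)
    (T : lcfun X Y) : Prop :=
  forall eps : R, 0 < eps -> exists2 delta : R, 0 < delta &
    forall y z : X, (ball x delta `&` A) y -> (ball x delta `&` A) z ->
      `|f z - f y - T (z - y)| <= eps * `|z - y|.

Definition condition_W (A : set X) (f : X -> Y) (G : X -> lcfun X Y) : Prop :=
  {within A, continuous G} /\
  forall x, A x -> strict_derivative_wrt A f x (G x).

(** Continuity of [Dg] is with respect to the operator norm. *)
Definition C1_on (Omega : set X) (g : X -> Y) : Prop :=
  exists2 Dg : X -> lcfun X Y,
    forall x, Omega x -> is_diff x g (Dg x) & {within Omega, continuous Dg}.

(** Lipschitz constants are required to be nonnegative: the library's
    [L.-lipschitz_A f] also holds with [L < 0] when [A] has at most one point. *)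
Definition property_LE : Prop :=
  exists2 C : R, 0 < C &
    forall (A : set X) (L : R) (f : X -> Y), 0 <= L -> L.-lipschitz_A f ->
      exists2 g : X -> Y, (C * L).-lipschitz g & forall x, A x -> g x = f x.

Definition property_LA1 : Prop :=
  exists2 C : R, 0 <= C &
    forall (L : R) (f : X -> Y) (eps : R), 0 <= L ->
      L.-lipschitz_(ball (0 : X) 1) f -> 0 < eps ->
      exists g : X -> Y, [/\ (C * L).-lipschitz_(ball (0 : X) 1) g,
        C1_on (ball (0 : X) 1) g &
        (ereal_sup [set `|f x - g x|%:E | x in ball (0%R : X) 1%R] <= eps%:E)%E].

End Definitions.

(* Main.v *)
Require Import Defs.
From HB Require Import structures.
From mathcomp Require Import all_boot all_order all_algebra.
From mathcomp Require Import all_classical all_reals all_analysis.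
From mathcomp Require Import ring lra.

Set Implicit Arguments.
Unset Strict Implicit.
Unset Printing Implicit Defensive.

Import Order.TTheory GRing.Theory Num.Theory.
Import numFieldNormedType.Exports.

Local Open Scope classical_set_scope.
Local Open Scope ring_scope.

(** The extension is obtained in two steps: [f] is first extended to a mapping
    [F], in general not smooth, that is strictly differentiable at every point
    of [A] with derivative [G], and [F] is then smoothed on the open set
    [Omega `\` A] without being disturbed near [A].

    First step. Near a point [a] of [A] the mapping [f - G a] has a small
    Lipschitz constant on [A]; property (LE) extends it there with a comparable
    constant, and adding [G a] back yields a local extension of [f]. All the
    local extensions have the same values at the points of [A], so a partition
    of unity glues them without creating any error at these points: for every [e] there is an extension
    [F_e] such that [F_e - G a] has local Lipschitz constant at most [e] at
    every [a] in [A] ([rough_extension]). The difference [E_n] of two successive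
    extensions of this kind, for [e = 2^-n], vanishes on [A] and has small local
    Lipschitz constant there; hence it has a small global Lipschitz constant on
    some neighbourhood of [A], and (LE) replaces it by a mapping [E_n'] on the
    whole space with the same germ along [A] ([germ_extension]). The series
    [F_0 + E_0' + E_1' + ...] coincides near each point of [A] with [F_N] up to
    a remainder with small Lipschitz constant, for every [N]: its sum is
    strictly differentiable on [A] ([strict_extension]).

    Second step. Around each [s] in [Omega `\` A] choose a ball on which, for
    some linear [T], the Lipschitz constant [kap s] of [F - T] is almost the
    least possible. Property (LA_1), transported to this ball, gives a smooth
    approximation of [F - T], hence of [F]; a smooth partition of unity glues
    the approximations into [g] ([smooth_approximation]). The local Lipschitz
    constant of [g - F] at [x] is controlled by the numbers [kap s] for [s]
    close to [x], which tend to [0] when [x] tends to a point [a] of [A] because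
    [T = G a] is then a good choice. So the derivative of [g] at [x] tends to
    [G a], and [g - F] is of second order at [A].

    Three tools are needed. Lipschitz constants are handled locally, through
    [lip_at f x c], for which sums and products behave exactly as derivatives
    do; [g] is smooth when [lip_at (g - T) x 0] is solvable in [T] at every
    point. Smooth partitions of unity ([exists_partition_of_unity]) combine
    Stone's proof of paracompactness with bumps provided by (LE) and (LA_1) for
    real functions. Norming functionals ([hahn_banach_norm]) give the passage
    from [Y]-valued to real functions and the mean value inequality. *)

Lemma choice2 (S T U : Type) (P : S -> T -> U -> Prop) :
  (forall x y, exists z, P x y z) -> exists f, forall x y, P x y (f x y).
Proof.
move=> H; exists (fun x => projT1 (choice (H x))) => x y.
by case: (choice (H x)) => /= f; exact.
Qed.

(** * Local Lipschitz constants *)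

Section LocalLipschitz.
Context {R : realType}.
Implicit Types X Y Z : normedModType R.

(** The limit, as the radius tends to [0], of the least Lipschitz constants of
    [f] on the balls around [x] is at most [c]. The slack [e] makes the rules
    for sums, products and composites hold without loss. *)
Definition lip_at X Y (f : X -> Y) (x : X) (c : R) : Prop :=
  forall e : R, 0 < e ->
    \forall p \near (x, x), `|f p.1 - f p.2| <= (c + e) * `|p.1 - p.2|.

Lemma lipschitzP X Y (A : set X) (c : R) (f : X -> Y) :
  c.-lipschitz_A f <->
  forall y z, A y -> A z -> `|f y - f z| <= c * `|y - z|.
Proof.
split=> [H y z Ay Az|H [y z] /= [Ay Az]]; last exact: H.
exact: (H (y, z)).
Qed.

Lemma near_pair X (x : X) (P : set X) :
  (\forall y \near x, P y) -> \forall p \near (x, x), P p.1 /\ P p.2.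
Proof. by move=> xP; exists (P, P). Qed.

Lemma near_pair_ball X (x : X) (P : set (X * X)) :
  (\forall p \near (x, x), P p) <->
  exists2 d : R, 0 < d & forall y z, ball x d y -> ball x d z -> P (y, z).
Proof.
split=> [[[A B] /= [/nbhs_ballP[a a0 xA] /nbhs_ballP[b b0 xB]] ABP]|].
  exists (Num.min a b); first by rewrite lt_min a0.
  move=> y z xy xz; apply: ABP; split => /=.
    by apply: xA; apply: le_ball xy; rewrite ge_min lexx.
  by apply: xB; apply: le_ball xz; rewrite ge_min lexx orbT.
move=> [d d0 dP]; apply: filterS (near_pair (nbhsx_ballx x _ d0)).
by move=> [y z] [/= ? ?]; exact: dP.
Qed.

Lemma lip_at_ball X Y (f : X -> Y) x c c' : lip_at f x c -> c < c' ->
  exists2 d : R, 0 < d & c'.-lipschitz_(ball x d) f.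
Proof.
move=> fx cc'; have : 0 < c' - c by rewrite subr_gt0.
move=> /fx; rewrite addrC subrK => /near_pair_ball[d d0 H].
by exists d => //; apply/lipschitzP => y z; exact: H.
Qed.

Lemma lipschitz_lip_at X Y (f : X -> Y) (A : set X) x c :
  nbhs x A -> c.-lipschitz_A f -> lip_at f x c.
Proof.
move=> xA /lipschitzP fA e e0; apply: filterS (near_pair xA) => p [p1 p2] /=.
by apply: le_trans (fA _ _ p1 p2) _; rewrite ler_wpM2r// lerDl ltW.
Qed.

Lemma lip_at_near X Y (f g : X -> Y) x c :
  (\forall y \near x, f y = g y) -> lip_at f x c -> lip_at g x c.
Proof.
move=> /near_pair fg fx e /fx fxe; near=> p.
have [<- <-] : f p.1 = g p.1 /\ f p.2 = g p.2 by near: p.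
by near: p.
Unshelve. all: by end_near.
Qed.

Lemma lip_atW X Y (f : X -> Y) x c c' :
  c <= c' -> lip_at f x c -> lip_at f x c'.
Proof.
move=> cc' fx e /fx; apply: filterS => p; move/le_trans; apply.
by rewrite ler_wpM2r// lerD2r.
Qed.

Lemma lip_at_inf X Y (f : X -> Y) x c :
  (forall e, 0 < e -> lip_at f x (c + e)) -> lip_at f x c.
Proof.
move=> H e e0; rewrite [e]splitr addrA; apply: H; by rewrite divr_gt0.
Qed.

Lemma lip_at_cst X Y (b : Y) (x : X) : lip_at (cst b) x 0.
Proof.
move=> e e0; near=> p; rewrite /= subrr normr0 add0r mulr_ge0//.
exact: ltW.
Unshelve. all: by end_near. Qed.

Lemma lip_atD X Y (f g : X -> Y) x c d :
  lip_at f x c -> lip_at g x d -> lip_at (f \+ g) x (c + d).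
Proof.
move=> fx gx e e0; have e20 : 0 < e / 2 by rewrite divr_gt0.
near=> p; rewrite /= opprD addrACA (le_trans (ler_normD _ _))//.
rewrite [e]splitr addrACA mulrDl lerD//; near: p; [exact: fx|exact: gx].
Unshelve. all: by end_near. Qed.

Lemma lip_atZ X Y (k : R) (f : X -> Y) x c :
  lip_at f x c -> lip_at (k \*: f) x (`|k| * c).
Proof.
move=> fx e e0; have k0 : 0 < `|k| + 1 by rewrite ltr_wpDl.
have : 0 < e / (`|k| + 1) by rewrite divr_gt0.
move=> /fx; apply: filterS => p fp; rewrite -scalerBr normrZ.
apply: le_trans (ler_wpM2l (normr_ge0 k) fp) _.
rewrite mulrA ler_wpM2r// mulrDr lerD2l mulrCA ger_pMr//.
by rewrite ler_pdivrMr// mul1r lerDl.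
Qed.

Lemma lip_atN X Y (f : X -> Y) x c : lip_at f x c -> lip_at (\- f) x c.
Proof.
move=> /(lip_atZ (-1)); rewrite normrN1 mul1r; apply: lip_at_near.
by apply: nearW => y /=; rewrite scaleN1r.
Qed.

Lemma lip_atB X Y (f g : X -> Y) x c d :
  lip_at f x c -> lip_at g x d -> lip_at (f \- g) x (c + d).
Proof. by move=> fx /lip_atN gx; exact: lip_atD. Qed.

Lemma lip_at_sum X Y (I : Type) (s : seq I) (f : I -> X -> Y) (c : I -> R) x :
  (forall i, lip_at (f i) x (c i)) ->
  lip_at (fun y => \sum_(i <- s) f i y) x (\sum_(i <- s) c i).
Proof.
move=> fx; elim: s => [|i s IH].
  rewrite big_nil; apply: lip_at_near (lip_at_cst 0 x).
  by apply: nearW => y; rewrite big_nil.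
rewrite big_cons; apply: lip_at_near (lip_atD (fx i) IH).
by apply: nearW => y; rewrite big_cons.
Qed.

Lemma lip_at_continuous X Y (f : X -> Y) x c :
  lip_at f x c -> {for x, continuous f}.
Proof.
move=> /(_ 1 ltr01)/near_pair_ball[d d0 H]; apply/cvgrPdist_le => e e0.
have c0 : 0 < `|c + 1| + 1 by rewrite ltr_wpDl.
have m0 : 0 < Num.min d (e / (`|c + 1| + 1)) by rewrite lt_min d0 divr_gt0.
near=> y; have : ball x (Num.min d (e / (`|c + 1| + 1))) y.
  by near: y; exact: nbhsx_ballx.
rewrite -ball_normE /= lt_min => /andP[xd xe].
apply: le_trans (H x y (ballxx _ d0) _) _ => /=; first by rewrite -ball_normE.
rewrite (@le_trans _ _ ((`|c + 1| + 1) * `|x - y|))//.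
  by rewrite ler_wpM2r// (le_trans (ler_norm _))// lerDl.
by rewrite mulrC -ler_pdivlMr// ltW.
Unshelve. all: by end_near. Qed.

(** The Leibniz rule: only the values of the factors at [x] matter, because
    both are continuous at [x]. *)
Lemma lip_atM X Y (u : X -> R) (f : X -> Y) x b c : 0 <= b -> 0 <= c ->
  lip_at u x b -> lip_at f x c ->
  lip_at (fun y => u y *: f y) x (`|u x| * c + b * `|f x|).
Proof.
move=> b0 c0 ux fx; apply: lip_at_inf => e e0.
pose K := c + b + 2 + `|u x| + `|f x|.
have K0 : 0 < K by rewrite /K ltr_wpDr// ltr_wpDr// ltr_wpDl// addr_ge0.
pose t := Num.min 1 (e / K).
have t0 : 0 < t by rewrite lt_min ltr01 divr_gt0.
have t1 : t <= 1 by rewrite ge_min lexx.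
have tK : t * K <= e by rewrite -ler_pdivlMr// ge_min lexx orbT.
have /near_pair nu : \forall y \near x, `|u x - u y| <= t.
  by move/lip_at_continuous/cvgrPdist_le : ux; apply.
have /near_pair nf : \forall y \near x, `|f x - f y| <= t.
  by move/lip_at_continuous/cvgrPdist_le : fx; apply.
move=> e' e'0; near=> p.
have up : `|u p.1 - u p.2| <= (b + t) * `|p.1 - p.2|.
  by near: p; exact: ux.
have fp : `|f p.1 - f p.2| <= (c + t) * `|p.1 - p.2|.
  by near: p; exact: fx.
have [nu1 _] : `|u x - u p.1| <= t /\ `|u x - u p.2| <= t by near: p; exact: nu.
have [_ nf2] : `|f x - f p.1| <= t /\ `|f x - f p.2| <= t by near: p; exact: nf.
have u1 : `|u p.1| <= `|u x| + t.
  by rewrite -lerBlDl (le_trans (lerB_dist _ _))// distrC.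
have f2 : `|f p.2| <= `|f x| + t.
  by rewrite -lerBlDl (le_trans (lerB_dist _ _))// distrC.
rewrite (_ : u p.1 *: f p.1 - u p.2 *: f p.2 =
  u p.1 *: (f p.1 - f p.2) + (u p.1 - u p.2) *: f p.2); last first.
  by rewrite scalerBr scalerBl addrA subrK.
rewrite (le_trans (ler_normD _ _))// !normrZ.
apply: (@le_trans _ _ ((`|u x| + t) * ((c + t) * `|p.1 - p.2|)
   + ((b + t) * `|p.1 - p.2|) * (`|f x| + t))).
  by apply: lerD; apply: ler_pM.
rewrite (_ : _ + _ = ((`|u x| + t) * (c + t) + (b + t) * (`|f x| + t)) *
   `|p.1 - p.2|); last by ring.
rewrite ler_wpM2r//.
apply: le_trans (_ : _ <= `|u x| * c + b * `|f x| + t * K) _; last first.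
  by rewrite -[leRHS]addrA lerD2l (le_trans tK)// lerDl ltW.
rewrite /K; have := normr_ge0 (u x); have := normr_ge0 (f x).
by move=> ? ?; nra.
Unshelve. all: by end_near. Qed.

Lemma ball_nbhs X (x s : X) (d : R) :
  ball s d x -> \forall y \near x, ball s d y.
Proof. by move=> sx; apply: open_nbhs_nbhs; split => //; exact: ball_open. Qed.

End LocalLipschitz.

(** * Norming functionals *)

Section HahnBanach.
Context {R : realType}.

Definition sublinear (V : lmodType R) (p : V -> R) : Prop :=
  (forall x y, p (x + y) <= p x + p y) /\
  (forall t x, 0 <= t -> p (t *: x) <= t * p x).

Lemma sublinear_ge (V : lmodType R) (p : V -> R) x y :
  sublinear p -> p y - p (- x) <= p (x + y).
Proof.
by move=> [pD _]; rewrite lerBlDl -[X in p X <= _](addKr x) pD.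
Qed.

(** It is below [p] and below [fun x => p (x + y) - p y]; so a functional [p]
    that is minimal among the sublinear ones satisfies
    [p x + p y <= p (x + y)]. *)
Definition sublinear_shift (V : lmodType R) (p : V -> R) (y x : V) : R :=
  inf [set p (x + t *: y) - t * p y | t in [set t : R | 0 <= t]].

Lemma sublinear_shift_has_inf (V : lmodType R) (p : V -> R) (y x : V) :
  sublinear p ->
  has_inf [set p (x + t *: y) - t * p y | t in [set t : R | 0 <= t]].
Proof.
move=> sp; split; first by exists (p (x + 0 *: y) - 0 * p y), 0 => //=.
exists (- p (- x)) => _ [t /= t0 <-]; rewrite lerBrDl.
have := sublinear_ge x (t *: y) sp.
have ty : t * p y <= p (t *: y).
  have [->|tn0] := eqVneq t 0.
    rewrite mul0r scale0r; have [pD _] := sp.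
    by have := pD 0 0; rewrite addr0 lerDl.
  have tp : 0 < t by rewrite lt_def tn0.
  rewrite -ler_pdivlMl//; have [_ pZ] := sp.
  have := @pZ t^-1 (t *: y); rewrite scalerA mulVf// scale1r; apply.
  by rewrite invr_ge0.
lra.
Qed.

Lemma sublinear_shift_le (V : lmodType R) (p : V -> R) (t : R) (y x : V) :
  sublinear p -> 0 <= t ->
  sublinear_shift p y x <= p (x + t *: y) - t * p y.
Proof.
move=> sp t0; apply: ge_inf; last by exists t.
by have [] := sublinear_shift_has_inf y x sp.
Qed.

Lemma sublinear_shift_sublinear (V : lmodType R) (p : V -> R) (y : V) :
  sublinear p -> sublinear (sublinear_shift p y).
Proof.
move=> sp; have [pD pZ] := sp.
have I0 x := (sublinear_shift_has_inf y x sp).1.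
split=> [x x'|t x t0].
  rewrite -lerBlDr; apply: lb_le_inf => // _ [t /= t0 <-].
  rewrite lerBlDl -lerBlDr; apply: lb_le_inf => // _ [s /= s0 <-].
  rewrite lerBlDr.
  apply: le_trans (sublinear_shift_le y _ sp (addr_ge0 t0 s0)) _.
  have := pD (x + t *: y) (x' + s *: y).
  by rewrite addrACA -scalerDl; lra.
have [->|tn0] := eqVneq t 0.
  rewrite mul0r (le_trans (sublinear_shift_le y _ sp (lexx 0)))//.
  rewrite !scale0r addr0 mul0r subr0.
  by have := pZ 0 0 (lexx 0); rewrite scale0r mul0r.
have tp : 0 < t by rewrite lt_def tn0.
rewrite -ler_pdivrMl//; apply: lb_le_inf => // _ [s /= s0 <-].
rewrite ler_pdivrMl//.
apply: le_trans (sublinear_shift_le y _ sp (mulr_ge0 t0 s0)) _.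
by rewrite -scalerA -scalerDr mulrBr mulrA lerD2r pZ.
Qed.

(** A minimal sublinear functional below [q], given by Zorn's lemma, coincides
    with all its shifts; hence it is superadditive, and therefore linear. This
    form of the Hahn-Banach theorem involves only functionals defined on the
    whole space. *)
Lemma linear_below_sublinear (V : lmodType R) (q : V -> R) : sublinear q ->
  exists2 l : V -> R, linear (l : V -> R^o) & forall x, l x <= q x.
Proof.
move=> sq.
pose S := {p : V -> R | sublinear p /\ forall x, p x <= q x}.
pose le (p p' : S) : bool := `[< forall x, sval p' x <= sval p x >].
have low (p : S) x : - q (- x) <= sval p x.
  have [sp pq] := svalP p; have := sublinear_ge x 0 sp.
  rewrite addr0; have := pq (- x); have := sp.1 0 0; rewrite addr0.
  lra.
have [|p|r s t|A tA|[p [sp pq]] pmax] := @ZL_preorder S _ le.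
- by exists q.
- by apply/asboolP.
- move=> /asboolP h1 /asboolP h2; apply/asboolP => x.
  exact: le_trans (h2 x) (h1 x).
- have [[p0 Ap0]|A0] := pselect (exists p, A p); last first.
    have q' : S by exists q.
    by exists q' => s As; case: A0; exists s.
  pose m x := inf [set sval p x | p in A].
  have mI x : has_inf [set sval p x | p in A].
    split; first by exists (sval p0 x), p0.
    by exists (- q (- x)) => _ [p Ap <-].
  have mle (p : S) x : A p -> m x <= sval p x.
    by move=> Ap; apply: ge_inf; [have [] := mI x | exists p].
  have mS : sublinear m /\ forall x, m x <= q x.
    split; last first.
      by move=> x; apply: le_trans (mle _ _ Ap0) _; case: (svalP p0).
    split=> [x x'|t x t0].
      rewrite -lerBlDr; apply: lb_le_inf; first by case: (mI x).
      move=> _ [p Ap <-]; rewrite lerBlDl -lerBlDr.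
      apply: lb_le_inf; first by case: (mI x').
      move=> _ [p' Ap' <-]; rewrite lerBlDr.
      have [pp'|p'p] := tA _ _ Ap Ap'.
        apply: le_trans (mle _ _ Ap') _.
        have [[pD _] _] := svalP p'; apply: le_trans (pD _ _) _.
        by rewrite addrC lerD2l; move/asboolP: pp'.
      apply: le_trans (mle _ _ Ap) _.
      have [[pD _] _] := svalP p; apply: le_trans (pD _ _) _.
      by rewrite addrC lerD2r; move/asboolP: p'p.
    have [->|tn0] := eqVneq t 0.
      rewrite mul0r (le_trans (mle _ _ Ap0))//.
      by have [[_ pZ] _] := svalP p0; rewrite (le_trans (pZ _ _ _))// mul0r.
    have tp : 0 < t by rewrite lt_def tn0.
    rewrite -ler_pdivrMl//; apply: lb_le_inf; first by case: (mI x).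
    move=> _ [p Ap <-]; rewrite ler_pdivrMl// (le_trans (mle _ _ Ap))//.
    by have [[_ pZ] _] := svalP p; exact: pZ.
  by exists (exist _ m mS) => p Ap; apply/asboolP => x /=; exact: mle.
have pD x y : p (x + y) = p x + p y.
  apply/eqP; rewrite eq_le sp.1 /=.
  have spy := sublinear_shift_sublinear y sp.
  have spyq z : sublinear_shift p y z <= q z.
    apply: le_trans (pq z).
    apply: le_trans (sublinear_shift_le y z sp (lexx 0)) _.
    by rewrite scale0r addr0 mul0r subr0.
  have := pmax (exist _ _ (conj spy spyq)).
  have le1 : le (exist _ p (conj sp pq)) (exist _ _ (conj spy spyq)).
    apply/asboolP => z /=.
    apply: le_trans (sublinear_shift_le y z sp (lexx 0)) _.
    by rewrite scale0r addr0 mul0r subr0.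
  move=> /(_ le1)/asboolP/(_ x)/= h.
  have := le_trans h (sublinear_shift_le y x sp ler01).
  by rewrite scale1r mul1r lerBrDr.
have p0 : p 0 = 0 by have := pD 0 0; rewrite addr0; lra.
have pN x : p (- x) = - p x by have := pD x (- x); rewrite subrr p0; lra.
have pZ t x : 0 <= t -> p (t *: x) = t * p x.
  move=> t0; apply/eqP; rewrite eq_le sp.2//=.
  by have := sp.2 t (- x) t0; rewrite scalerN !pN mulrN lerN2.
exists p => // t x y; rewrite pD; congr (_ + _).
have [/pZ//|t0] := leP 0 t.
rewrite -[t in LHS]opprK scaleNr pN pZ ?oppr_ge0 ?(ltW t0)//.
by rewrite mulNr opprK.
Qed.


Lemma bounded_linear_lcfun (X Y : normedModType R) (f : X -> Y) (M : R) :
  linear f -> (forall x, `|f x| <= M * `|x|) ->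
  exists T : lcfun X Y, forall x, T x = f x.
Proof.
move=> fl fM.
have fB y z : f y - f z = f (y - z).
  have -> : y - z = (-1) *: z + y by rewrite scaleN1r addrC.
  by rewrite fl scaleN1r addrC.
have fc : continuous f.
  move=> x; apply: (@lip_at_continuous _ _ _ _ _ M).
  apply: (@lipschitz_lip_at _ _ _ _ setT); first exact: filterT.
  by apply/lipschitzP => y z _ _; rewrite fB.
have fP : f \in @lcfun_pred R X Y by rewrite inE.
by exists (LCFun fP).
Qed.

(** Shifting the norm by [y] forces [l (- y) <= - `|y|] for every linear [l]
    below the shifted functional. *)
Lemma hahn_banach_norm (Y : normedModType R) (y : Y) :
  exists l : lcfun Y R, l y = `|y| /\ forall z, `|l z| <= `|z|.
Proof.
have sn : sublinear (fun z : Y => `|z|).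
  by split=> [*|t x t0]; [exact: ler_normD|rewrite normrZ ger0_norm].
have [l ll lq] := linear_below_sublinear (sublinear_shift_sublinear y sn).
have lN z : l (- z) = - l z.
  have l0 : l 0 = 0 by have := ll 1 0 0; rewrite !scale1r addr0; lra.
  by have := ll (-1) z 0; rewrite addr0 l0 addr0 !scaleN1r.
have ln z : l z <= `|z|.
  apply: le_trans (lq z) _.
  apply: le_trans (sublinear_shift_le y z sn (lexx 0)) _.
  by rewrite scale0r addr0 mul0r subr0.
have lb z : `|l z| <= 1 * `|z|.
  by rewrite mul1r ler_norml ln andbT lerNl -lN -normrN ln.
have [L LE] := bounded_linear_lcfun ll lb.
exists L; split; last by move=> z; rewrite LE (le_trans (lb z))// mul1r.
apply/eqP; rewrite eq_le !LE ln /= -lerN2 -lN.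
apply: le_trans (lq _) _; apply: le_trans (sublinear_shift_le y _ sn ler01) _.
by rewrite scale1r addNr normr0 mul1r sub0r.
Qed.

End HahnBanach.

(** * Strict differentiability *)

Section StrictDerivative.
Context {R : realType}.
Implicit Types X Y Z : normedModType R.

Lemma is_diff_eps X Y (f : X -> Y) (x : X) (T : lcfun X Y) :
  (forall e : R, 0 < e ->
     \forall y \near x, `|f y - f x - T (y - x)| <= e * `|y - x|) ->
  is_diff x f T.
Proof.
move=> H.
have E : f \o shift x = cst (f x) + (T : X -> Y) +o_ 0 id.
  apply/eqaddoP => e /H; rewrite (near_shift 0) subr0; apply: filterS => h /=.
  rewrite addrK.
  by rewrite -[(_ - _) h]/(f (h + x) - (f x + T h)) opprD addrA.
have dE := diff_unique (@lcfun_continuous _ _ _ T) E.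
apply: DiffDef => //; apply/diff_locallyP; rewrite dE; split => //.
exact: lcfun_continuous.
Qed.

Lemma is_diff_lcfun X Y (T : lcfun X Y) x : is_diff x T T.
Proof.
apply: is_diff_eps => e e0; apply: nearW => y.
by rewrite -linearB subrr normr0 mulr_ge0// ltW.
Qed.

Lemma lipschitz_lcfun X Y (T : lcfun X Y) (A : set X) :
  (opnorm T).-lipschitz_A T.
Proof. by apply/lipschitzP => y z _ _; rewrite -linearB le_opnorm. Qed.

Lemma lip_at_lcfun X Y (T : lcfun X Y) x : lip_at T x (opnorm T).
Proof.
apply: (@lipschitz_lip_at _ _ _ _ setT); first exact: filterT.
exact: lipschitz_lcfun.
Qed.

Lemma opnorm_le_lip_at X Y (T : lcfun X Y) x c :
  0 <= c -> lip_at T x c -> opnorm T <= c.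
Proof.
move=> c0 Tx; apply/ler_addgt0Pr => e e0.
have ce : c < c + e by rewrite ltrDl.
have [d d0 /lipschitzP H] := lip_at_ball Tx ce.
apply: opnorm_lub => v v1.
have [t t0 td] : exists2 t, 0 < t & t < d.
  by exists (d / 2); rewrite ?divr_gt0// ltr_pdivrMr// ltr_pMr// ltr1n.
have := H (x + t *: v) x.
rewrite -ball_normE /= opprD addNKr normrN subrr normr0 -linearB.
rewrite [x + _ - x]addrC addKr linearZ /= !normrZ (gtr0_norm t0).
have dv : t * `|v| < d by rewrite (le_lt_trans _ td)// ger_pMr.
move=> /(_ dv d0); rewrite mulrCA ler_pM2l// => /le_trans; apply.
by rewrite ger_pMr// ltr_wpDl.
Qed.


(** Strict differentiability of [f] at [x], with derivative [T]. *)
Definition sdiff X Y (f : X -> Y) (x : X) (T : lcfun X Y) : Prop :=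
  lip_at (f \- T) x 0.

Definition sdiffable X Y (f : X -> Y) (x : X) : Prop := exists T, sdiff f x T.

Lemma sdiff_is_diff X Y (f : X -> Y) x T : sdiff f x T -> is_diff x f T.
Proof.
move=> fx; apply: is_diff_eps => e e0.
have [d d0 /lipschitzP H] := lip_at_ball fx e0.
near=> y; have xy : ball x d y by near: y; exact: nbhsx_ballx.
have := H y x xy (ballxx _ d0).
by rewrite /= (linearB T) /= !opprD !opprK addrACA.
Unshelve. all: by end_near. Qed.

(** A strict derivative is as close to [S] as [f] itself is, in the sense of
    local Lipschitz constants; this is how the derivative of the final mapping
    is shown to be continuous. *)
Lemma sdiff_opnorm X Y (f : X -> Y) x T (S : lcfun X Y) c : 0 <= c ->
  sdiff f x T -> lip_at (f \- S) x c -> opnorm (T - S) <= c.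
Proof.
move=> c0 fT fS; apply: opnorm_le_lip_at => //.
have := lip_atB fS fT; rewrite addr0; apply: lip_at_near; apply: nearW => y /=.
by rewrite opprB addrC addrA subrK.
Qed.

Lemma sdiff_lip_at X Y (f : X -> Y) x T :
  sdiff f x T -> lip_at f x (opnorm T).
Proof.
move=> fT; have := lip_atD fT (lip_at_lcfun T x); rewrite add0r.
by apply: lip_at_near; apply: nearW => y /=; rewrite subrK.
Qed.

Lemma sdiffable_near X Y (f g : X -> Y) x :
  (\forall y \near x, f y = g y) -> sdiffable f x -> sdiffable g x.
Proof.
move=> fg [T fT]; exists T; apply: lip_at_near fT.
by apply: filterS fg => y /= ->.
Qed.

Lemma sdiff0 X Y (f : X -> Y) x : lip_at f x 0 -> sdiffable f x.
Proof.
by exists 0; apply: lip_at_near H; apply: nearW => y /=; rewrite subr0.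
Qed.

Lemma sdiffable_cst X Y (b : Y) (x : X) : sdiffable (cst b) x.
Proof. exact/sdiff0/lip_at_cst. Qed.

Lemma sdiffable_lcfun X Y (T : lcfun X Y) x : sdiffable T x.
Proof.
exists T; apply: lip_at_near (lip_at_cst 0 x).
by apply: nearW => y /=; rewrite subrr.
Qed.

Lemma sdiffableD X Y (f g : X -> Y) x :
  sdiffable f x -> sdiffable g x -> sdiffable (f \+ g) x.
Proof.
move=> [S fS] [T gT]; exists (S + T); have := lip_atD fS gT; rewrite addr0.
apply: lip_at_near; apply: nearW => y /=.
by rewrite opprD addrACA.
Qed.

(** The remainder of the product splits as
    [(u - u x)(f - f x) + u x (f - T) + (u - S) f x], and each term has local
    Lipschitz constant [0] at [x]. *)
Lemma sdiffableM X Y (u : X -> R) (f : X -> Y) x :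
  sdiffable u x -> sdiffable f x -> sdiffable (fun y => u y *: f y) x.
Proof.
move=> [S uS] [T fT].
have [P PE] : exists P : lcfun X Y, forall v, P v = S v *: f x.
  apply: (@bounded_linear_lcfun _ _ _ _ (opnorm S * `|f x|)) => [a v w|v].
    by rewrite linearP /= scalerDl scalerA.
  by rewrite normrZ mulrAC ler_wpM2r// le_opnorm.
exists (u x *: T + P); rewrite /sdiff.
have h1 : lip_at (fun y => (u y - u x) *: (f y - f x)) x 0.
  have hu := lip_atB (sdiff_lip_at uS) (lip_at_cst (u x) x).
  have hf := lip_atB (sdiff_lip_at fT) (lip_at_cst (f x) x).
  have := lip_atM _ _ hu hf; rewrite /= !subrr !normr0 mul0r mulr0 !addr0.
  by apply; exact: opnorm_ge0.
have h2 := lip_atZ (u x) fT.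
have h3 : lip_at (fun y => (u y - S y) *: f x) x 0.
  have := lip_atM (lexx 0) (lexx 0) uS (lip_at_cst (f x) x).
  by rewrite mulr0 mul0r addr0.
have h4 := lip_at_cst (- (u x *: f x)) x.
have := lip_atD (lip_atD (lip_atD h1 h2) h3) h4; rewrite mulr0 !addr0.
apply: lip_at_near; apply: nearW => y /=.
rewrite scalerBr !scalerBl scalerBr opprB -!addrA; congr (_ + _).
rewrite [RHS](_ : _ = - (u x *: T y + S y *: f x)); last by rewrite -PE.
rewrite !addrA [LHS](ACl ((1*4)*(2*8)*(3*6)*(5*7))) /=.
by rewrite !addNr subrr !add0r opprD.
Qed.

Lemma lip_at_comp X Y Z (f : X -> Y) (h : Y -> Z) x c d : 0 <= c -> 0 <= d ->
  lip_at f x c -> lip_at h (f x) d -> lip_at (h \o f) x (d * c).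
Proof.
move=> c0 d0 fx hfx; apply: lip_at_inf => e e0.
pose K := c + d + 1.
have K0 : 0 < K by rewrite ltr_wpDl// addr_ge0.
pose t := Num.min 1 (e / K).
have t0 : 0 < t by rewrite lt_min ltr01 divr_gt0.
have t1 : t <= 1 by rewrite ge_min lexx.
have tK : t * K <= e by rewrite -ler_pdivlMr// ge_min lexx orbT.
have [|r r0 /lipschitzP H] := @lip_at_ball _ _ _ _ _ _ (d + t) hfx.
  by rewrite ltrDl.
have /near_pair nf : \forall y \near x, ball (f x) r (f y).
  exact: (lip_at_continuous fx (nbhsx_ballx _ _ r0)).
move=> e' e'0; near=> p.
have [f1 f2] : ball (f x) r (f p.1) /\ ball (f x) r (f p.2).
  by near: p; exact: nf.
have fp : `|f p.1 - f p.2| <= (c + t) * `|p.1 - p.2| by near: p; exact: fx.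
apply: le_trans (H _ _ f1 f2) _.
apply: (@le_trans _ _ ((d + t) * ((c + t) * `|p.1 - p.2|))).
  by rewrite ler_wpM2l// addr_ge0// ltW.
rewrite mulrA ler_wpM2r//; rewrite /K in tK; nra.
Unshelve. all: by end_near. Qed.

Lemma sdiffable_comp X Y Z (f : X -> Y) (h : Y -> Z) x :
  sdiffable f x -> sdiffable h (f x) -> sdiffable (h \o f) x.
Proof.
move=> [T fT] [S hS].
have [P PE] : exists P : lcfun X Z, forall v, P v = S (T v).
  apply: (@bounded_linear_lcfun _ _ _ _ (opnorm S * opnorm T)) => [a v w|v].
    by rewrite !linearP.
  rewrite (le_trans (le_opnorm _ _))// -mulrA ler_wpM2l ?opnorm_ge0//.
  exact: le_opnorm.
exists P.
have h1 := lip_at_comp (opnorm_ge0 T) (lexx 0) (sdiff_lip_at fT) hS.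
have h2 := lip_at_comp (lexx 0) (opnorm_ge0 S) fT (lip_at_lcfun S _).
have := lip_atD h1 h2; rewrite mul0r mulr0 addr0.
apply: lip_at_near; apply: nearW => y /=.
by rewrite PE (linearB S) addrA subrK.
Qed.

Lemma mean_value01 (h dh : R -> R) :
  (forall t : R, t \in `[0, 1] -> is_derive t (1 : R) h (dh t)) ->
  exists2 t : R, t \in `[0, 1] & h 1 - h 0 = dh t.
Proof.
move=> hd; have h01 : (0 : R) <= 1 by exact: ler01.
have hd1 : forall x : R, x \in `]0, 1[ -> is_derive x 1 h (dh x).
  by move=> t t01; apply: hd; apply: subset_itv_oo_cc.
have hc : {within `[0, 1], continuous h}.
  by apply: derivable_within_continuous => t /hd [? _].
have [t t01 E] := @MVT_segment R h dh 0 1 h01 hd1 hc.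
by exists t => //; rewrite E subr0 mulr1.
Qed.

(** Compose [f] along a segment with a functional that norms the increment of
    [f], and apply the real mean value theorem. *)
Lemma lipschitz_mean_value X Y (f : X -> Y) (D : X -> lcfun X Y) (x : X)
    (r c : R) :
  (forall y, ball x r y -> is_diff y f (D y)) ->
  (forall y, ball x r y -> opnorm (D y) <= c) ->
  c.-lipschitz_(ball x r) f.
Proof.
move=> fD Dc; apply/lipschitzP => z y xz xy.
have [l [lE ln]] := hahn_banach_norm (f z - f y).
pose g (t : R) : X := y + t *: (z - y).
pose h : R -> R := l \o (f \o g).
pose dh (t : R) : R := l (D (g t) (z - y)).
have gb (t : R) : t \in `[0, 1] -> ball x r (g t).
  rewrite in_itv /= => /andP[t0 t1].
  move: xz xy; rewrite -ball_normE /= => xz xy.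
  have -> : x - g t = (1 - t) *: (x - y) + t *: (x - z).
    have E : z - y = (x - y) - (x - z) by rewrite opprB [RHS]addrC addrA subrK.
    rewrite /g E scalerBr opprD opprB addrA [t *: (x - z) - _]addrC addrA.
    by rewrite scalerBl scale1r.
  apply: le_lt_trans (ler_normD _ _) _; rewrite !normrZ !ger0_norm ?subr_ge0//.
  have [m [mr my mz]] : exists m, [/\ m < r, `|x - y| <= m & `|x - z| <= m].
    by exists (Num.max `|x - y| `|x - z|); rewrite gt_max xy !le_max !lexx orbT.
  apply: le_lt_trans mr.
  rewrite [leRHS](_ : m = (1 - t) * m + t * m); last by ring.
  by rewrite lerD// ler_wpM2l ?subr_ge0.
have hd (t : R) : t \in `[0, 1] -> is_derive t (1 : R) h (dh t).
  move=> /gb /fD fgt.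
  have gd : is_diff t g ( *:%R^~ (z - y)).
    have -> : g = cst y + ( *:%R^~ (z - y)) by [].
    exact: (is_diff_eq (is_diffD (is_diff_cst y t) (is_diff_scalel t (z - y)))
      (add0r _)).
  have ld := is_diff_lcfun l (f (g t)).
  have hd : is_diff t h (l \o (D (g t) \o ( *:%R^~ (z - y)))).
    have hd1 : is_diff t (f \o g) (D (g t) \o ( *:%R^~ (z - y))).
      exact: is_diff_comp.
    exact: (is_diff_comp hd1 ld).
  have hdv : derivable h t 1.
    by apply: diff_derivable; case: hd.
  apply: DeriveDef => //.
  rewrite deriveE; last by case: hd.
  by case: hd => _ ->; rewrite /= scale1r.
have [t t01 E] := mean_value01 hd.
have -> : `|f z - f y| = dh t.
  by rewrite -lE linearB -E /h /g /= scale1r scale0r addr0 [y + _]addrC subrK.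
rewrite (le_trans (ler_norm _))// (le_trans (ln _))//.
rewrite (le_trans (le_opnorm _ _))// ler_wpM2r// Dc//; exact: gb.
Qed.

(** The mean value inequality applied to [f - D x], whose derivative is small
    near [x]. *)
Lemma C1_on_sdiffable X Y (O : set X) (f : X -> Y) x :
  open O -> C1_on O f -> O x -> sdiffable f x.
Proof.
move=> oO [D fD Dc] Ox; exists (D x) => e e0; rewrite add0r.
have Ox1 : x \in O by rewrite inE.
move: Dc; rewrite continuous_open_subspace// => /(_ x Ox1) Dx.
have : \forall y \near x, O y /\ opnorm (D y - D x) <= e.
  near=> y; split; first by near: y; exact: open_nbhs_nbhs.
  have : `|D x - D y| <= e by near: y; move/cvgrPdist_le : Dx; exact.
  by rewrite distrC.
move=> /nbhs_ballP[r r0 xr].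
have := @lipschitz_mean_value _ _ (f \- D x) (fun y => D y - D x) x r e.
move=> /(_ _ (fun y xy => (xr y xy).2)) H.
have {}H := H (fun y xy => is_diffB (fD y (xr y xy).1) (is_diff_lcfun (D x) y)).
apply/near_pair_ball; exists r => // y z xy xz /=.
by move/lipschitzP : H; apply.
Unshelve. all: by end_near. Qed.

End StrictDerivative.

(** * Smoothing on balls and real-valued Lipschitz extension *)

Section Smoothing.
Context {R : realType}.
Implicit Types X Y : normedModType R.

(** Property (LA_1) on arbitrary balls, with strict differentiability in place
    of the C^1 class. *)
Definition ball_smoothing X Y (C : R) : Prop :=
  forall (s : X) (r L : R) (u : X -> Y) (eta : R), 0 < r -> 0 <= L ->
    L.-lipschitz_(ball s r) u -> 0 < eta ->
    exists v : X -> Y, [/\ (C * L).-lipschitz_(ball s r) v,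
      forall x, ball s r x -> sdiffable v x &
      forall x, ball s r x -> `|u x - v x| <= eta].

(** Rescaling [z |-> s + r z] multiplies Lipschitz constants by [r], and the
    inverse rescaling divides them by [r]: the constant of the property is the
    same on all balls. *)
Lemma ball_smoothing_LA1 X Y : property_LA1 X Y ->
  exists2 C : R, 0 <= C & ball_smoothing X Y C.
Proof.
move=> [C C0 H]; exists C => // s r L u eta r0 L0 /lipschitzP uL eta0.
pose up z := s + r *: z; pose dn x := r^-1 *: (x - s).
have upK x : up (dn x) = x.
  by rewrite /up /dn scalerA divff ?gt_eqF// scale1r addrC subrK.
have dn1 x : ball s r x -> ball 0 1 (dn x).
  rewrite -!ball_normE /= => sx.
  rewrite sub0r normrN normrZ gtr0_norm ?invr_gt0//.
  by rewrite ltr_pdivrMl// mulr1 distrC.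
have dnB x y : `|dn x - dn y| = r^-1 * `|x - y|.
  rewrite -scalerBr normrZ gtr0_norm ?invr_gt0// opprB addrA subrK.
  by [].
have uupL : (r * L).-lipschitz_(ball (0 : X) 1) (u \o up).
  have upb z : ball 0 1 z -> ball s r (up z).
    rewrite -!ball_normE /= sub0r normrN => z1.
    by rewrite opprD addNKr normrN normrZ gtr0_norm// gtr_pMr.
  apply/lipschitzP => y z y1 z1 /=.
  apply: le_trans (uL _ _ (upb _ y1) (upb _ z1)) _.
  rewrite opprD addrACA subrr add0r -scalerBr normrZ gtr0_norm//.
  by rewrite mulrCA mulrA.
have [g [/lipschitzP gL gC1 gu]] := H _ _ _ (mulr_ge0 (ltW r0) L0) uupL eta0.
exists (g \o dn); split.
- apply/lipschitzP => y z ys zs /=.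
  apply: le_trans (gL _ _ (dn1 _ ys) (dn1 _ zs)) _.
  rewrite dnB (_ : C * (r * L) * _ = C * L * `|y - z|)//.
  by field; rewrite gt_eqF.
- move=> x sx; apply: sdiffable_comp.
    have [T TE] : exists T : lcfun X X, forall v, T v = r^-1 *: v.
      apply: (@bounded_linear_lcfun _ _ _ _ r^-1) => [a v w|v].
        by rewrite scalerDr !scalerA mulrC.
      by rewrite normrZ gtr0_norm ?invr_gt0.
    apply: sdiffable_near (sdiffableD (sdiffable_lcfun T x)
      (sdiffable_cst (- (r^-1 *: s)) x)).
    by apply: nearW => y /=; rewrite TE /dn scalerBr.
  by apply: C1_on_sdiffable gC1 (dn1 _ sx); exact: ball_open.
- move=> x sx; rewrite -lee_fin; apply: le_trans gu.
  apply: ereal_sup_ubound; exists (dn x); first exact: dn1.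
  by rewrite /= upK.
Qed.

(** A real function [u] is smoothed through the [Y]-valued function
    [u *: y0], followed by a functional norming [y0]. *)
Lemma ball_smoothing_real X Y (C : R) (y0 : Y) : y0 != 0 ->
  ball_smoothing X Y C -> ball_smoothing X R C.
Proof.
move=> y0n0 H s r L u eta r0 L0 /lipschitzP uL eta0.
have ny0 : 0 < `|y0| by rewrite normr_gt0.
have [l [ly0 ln]] := hahn_banach_norm y0.
have uyL : (L * `|y0|).-lipschitz_(ball s r) (fun x => u x *: y0).
  apply/lipschitzP => y z ys zs.
  by rewrite -scalerBl normrZ mulrAC ler_wpM2r// uL.
have [v [/lipschitzP vL vd vu]] := H _ _ _ _ _ r0 (mulr_ge0 L0 (ltW ny0)) uyL
  (mulr_gt0 eta0 ny0).
exists (fun x => `|y0|^-1 *: l (v x)); split.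
- apply/lipschitzP => y z ys zs.
  rewrite -scalerBr normrZ gtr0_norm ?invr_gt0// ler_pdivrMl//.
  rewrite -linearB (le_trans (ln _))// (le_trans (vL _ _ ys zs))//.
  suff -> : C * (L * `|y0|) * `|y - z| = `|y0| * (C * L * `|y - z|) by [].
  by ring.
- move=> x /vd vx; apply: (@sdiffableM _ _ _ (cst `|y0|^-1) (l \o v)).
    exact: sdiffable_cst.
  exact: sdiffable_comp vx (sdiffable_lcfun l _).
- move=> x /vu ux.
  have -> : u x = `|y0|^-1 *: l (u x *: y0).
    rewrite linearZ /= ly0 scalerA mulrC -scalerA.
    by rewrite [_ *: `|y0|]mulVf ?gt_eqF// [_ *: 1]mulr1.
  rewrite -scalerBr normrZ gtr0_norm ?invr_gt0// ler_pdivrMl// mulrC.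
  by rewrite -linearB (le_trans (ln _)).
Qed.

Definition lipschitz_extension X Y (C : R) : Prop :=
  forall (A : set X) (L : R) (f : X -> Y), 0 <= L -> L.-lipschitz_A f ->
    exists2 g : X -> Y, (C * L).-lipschitz g & forall x, A x -> g x = f x.

Lemma property_LE_real X Y (y0 : Y) : y0 != 0 ->
  property_LE X Y -> property_LE X R.
Proof.
move=> y0n0 [C C0 H]; exists C => // A L u L0 /lipschitzP uL.
have ny0 : 0 < `|y0| by rewrite normr_gt0.
have [l [ly0 ln]] := hahn_banach_norm y0.
have uyL : (L * `|y0|).-lipschitz_A (fun x => u x *: y0).
  apply/lipschitzP => y z ys zs.
  by rewrite -scalerBl normrZ mulrAC ler_wpM2r// uL.
have [v /lipschitzP vL vu] := H _ _ _ (mulr_ge0 L0 (ltW ny0)) uyL.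
exists (fun x => `|y0|^-1 *: l (v x)).
  apply/lipschitzP => y z ys zs.
  rewrite -scalerBr normrZ gtr0_norm ?invr_gt0// ler_pdivrMl//.
  rewrite -linearB (le_trans (ln _))// (le_trans (vL _ _ ys zs))//.
  suff -> : C * (L * `|y0|) * `|y - z| = `|y0| * (C * L * `|y - z|) by [].
  by ring.
move=> x Ax; rewrite vu// linearZ /= ly0 scalerA mulrC -scalerA.
by rewrite [_ *: `|y0|]mulVf ?gt_eqF// [_ *: 1]mulr1.
Qed.

End Smoothing.

(** * Smooth bumps *)

Section Bumps.
Context {R : realType}.
Implicit Types X Y : normedModType R.

Definition sqpos (t : R) : R := Num.max 0 t * Num.max 0 t.

Lemma dist_max0 (a b : R) : `|Num.max 0 a - Num.max 0 b| <= `|a - b|.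
Proof.
have := ler_norm (a - b); have := ler_norm (b - a); rewrite [`|b - a|]distrC.
by have [?|?] := leP 0 a; have [?|?] := leP 0 b; rewrite ler_norml; lra.
Qed.

(** At a zero of [q] the positive part of [q] is Lipschitz and vanishes, so its
    square has local Lipschitz constant [0]. *)
Lemma sdiffable_sqpos X (q : X -> R) x :
  sdiffable q x -> sdiffable (fun y => sqpos (q y)) x.
Proof.
move=> qx; have [T qT] := qx; have qc := lip_at_continuous (sdiff_lip_at qT).
have [q0|q0|q0] := ltgtP (q x) 0.
- apply: sdiffable_near (sdiffable_cst (0 : R) x).
  have : \forall y \near x, q y < 0 by exact: (cvgr_lt _ qc).
  by apply: filterS => y qy; rewrite /sqpos max_l ?mulr0// ltW.
- apply: sdiffable_near (sdiffableM qx qx).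
  have : \forall y \near x, 0 < q y by exact: (cvgr_gt _ qc).
  by apply: filterS => y qy; rewrite /sqpos max_r// ltW.
- apply: sdiff0.
  have u : lip_at (fun y => Num.max 0 (q y)) x (opnorm T).
    move=> e /(sdiff_lip_at qT) qe; near=> p.
    by apply: le_trans (dist_max0 _ _) _; near: p.
  have := lip_atM (opnorm_ge0 T) (opnorm_ge0 T) u u.
  by rewrite q0 maxxx normr0 mul0r mulr0 addr0.
Unshelve. all: by end_near. Qed.

(** A C^1 step from [1] (on the left of [1/4]) to [0] (on the right of [3/4])
    built from [sqpos] alone, so that [sdiffable_sqpos] gives its smoothness. *)
Definition smooth_step (t : R) : R := sqpos (1 - sqpos (2 * t - 2^-1)).

Lemma smooth_step_itv t : 0 <= smooth_step t <= 1.
Proof.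
rewrite /smooth_step /sqpos; set p := Num.max 0 (2 * t - 2^-1).
have : 0 <= Num.max 0 (1 - p * p) <= 1.
  rewrite le_max lexx /= ge_max ler01 /= gerBl -expr2 sqr_ge0; by [].
by move=> /andP[a b]; rewrite mulr_ge0//= mulr_ile1.
Qed.

Lemma smooth_step_le t : t <= 4^-1 -> smooth_step t = 1.
Proof.
move=> t4; rewrite /smooth_step /sqpos.
rewrite [Num.max 0 (2 * t - _)]max_l; last by lra.
by rewrite mulr0 subr0 max_r// mulr1.
Qed.

Lemma smooth_step_ge t : 3 / 4 <= t -> smooth_step t = 0.
Proof.
move=> t4; rewrite /smooth_step /sqpos.
rewrite [Num.max 0 (2 * t - _)]max_r; last by lra.
by rewrite max_l ?mulr0//; nra.
Qed.

Lemma lipschitz_smooth_step : (8 : R).-lipschitz smooth_step.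
Proof.
pose k (t : R) := Num.max 0 (Num.min 1 (2 * t - 2^-1)).
have k01 t : 0 <= k t <= 1.
  by rewrite /k le_max lexx /= ge_max ler01 ge_min lexx.
have sE t : smooth_step t = (1 - k t * k t) * (1 - k t * k t).
  rewrite /smooth_step /sqpos /k; have [p1|p1] := leP 1 (2 * t - 2^-1).
    rewrite (@max_r _ _ 0 1)// mulr1 subrr mulr0 max_l ?mulr0//.
    rewrite max_r; [nra|lra].
  have [p0|p0] := leP 0 (2 * t - 2^-1).
    by rewrite max_r//; nra.
  by rewrite mulr0 subr0 max_r.
have kL t t' : `|k t - k t'| <= 2 * `|t - t'|.
  apply: le_trans (dist_max0 _ _) _; rewrite !minEle.
  have -> : 2 * `|t - t'| = `|(2 * t - 2^-1) - (2 * t' - 2^-1)|.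
    by rewrite opprB addrA subrK -mulrBr normrM ger0_norm.
  move: (2 * t - 2^-1) (2 * t' - 2^-1) => a b.
  by case: ifPn; case: ifPn => *; rewrite ler_norml; have := ler_norm (a - b);
    have := ler_norm (b - a); rewrite [`|b - a|]distrC; lra.
apply/lipschitzP => t t' _ _; rewrite !sE.
move: (k01 t) (k01 t') (kL t t').
move: (k t) (k t') => a b /andP[a0 a1] /andP[b0 b1] ab.
rewrite [X in `|X| <= _]
  (_ : _ = (b - a) * ((b + a) * (2 - a * a - b * b))); last by ring.
rewrite normrM distrC.
have : `|(b + a) * (2 - a * a - b * b)| <= 4.
  rewrite ger0_norm; nra.
move=> h; apply: (@le_trans _ _ ((2 * `|t - t'|) * 4)); first exact: ler_pM.
by rewrite mulrAC -natrM.
Qed.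


(** The bump is a smooth step applied to a smoothing [v], within [1/4] on the
    ball, of a Lipschitz function equal to [0] near [E] and to [1] away from
    [E]. The points between the two regions are left to the Lipschitz extension
    property. As [E] lies at depth [c] in the ball, the bump vanishes near the
    boundary of the ball and can be extended by [0]. *)
Lemma exists_bump X (C1 C2 : R) : 0 <= C1 -> 0 <= C2 ->
  ball_smoothing X R C1 ->
  lipschitz_extension X R C2 ->
  forall (E : set X) (s : X) (r c : R), 0 < r -> 0 < c ->
    (forall x, E x -> ball x c `<=` ball s r) ->
  exists psi : X -> R, [/\ forall x, 0 <= psi x <= 1,
    forall e x, E e -> ball e (c / 8) x -> psi x = 1,
    forall x, psi x != 0 -> exists2 e, E e & ball e (c / 4) x,
    forall x, sdiffable psi x &
    forall x, lip_at psi x (64 * C1 * C2 / c)].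
Proof.
move=> C10 C20 hS hE E s r c r0 c0 Es.
pose near d x := exists2 e, E e & ball e d x.
pose chi x : R := if `[< near (c / 8) x >] then 0 else 1.
have L0 : 0 <= 8 / c by rewrite divr_ge0// ltW.
have chiL :
    (8 / c).-lipschitz_([set x | near (c / 8) x \/ ~ near (c / 4) x]) chi.
  have far y z : near (c / 8) y -> ~ near (c / 4) z -> c / 8 <= `|y - z|.
    move=> [e Ee ey] nz; rewrite leNgt; apply/negP => yz; apply: nz.
    exists e => //.
    move: ey; rewrite -!ball_normE /= => ey.
    by have := ler_distD y e z; lra.
  have D y z : near (c / 8) y -> ~ near (c / 4) z -> 1 <= 8 / c * `|y - z|.
    move=> yn zn; have := far _ _ yn zn.
    by rewrite mulrAC ler_pdivlMr// mul1r; lra.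
  have mono y : near (c / 8) y -> near (c / 4) y.
    by move=> [e Ee ey]; exists e => //; apply: le_ball ey; lra.
  apply/lipschitzP => y z /=; rewrite /chi.
  case: asboolP => yn; case: asboolP => zn yA zA.
  - by rewrite subrr normr0 mulr_ge0.
  - by rewrite sub0r normrN normr1 D//; case: zA.
  - by rewrite subr0 normr1 distrC D//; case: yA.
  - by rewrite subrr normr0 mulr_ge0.
have [w wL wchi] := hE _ _ _ L0 chiL.
have wL' : (C2 * (8 / c)).-lipschitz_(ball s r) w.
  by move/lipschitzP : wL => wL; apply/lipschitzP => y z _ _; exact: wL.
have e40 : (0 : R) < 4^-1 by [].
have [v [vL vd vw]] := hS _ _ _ _ _ r0 (mulr_ge0 C20 L0) wL' e40.
have v1 x : ball s r x -> near (c / 8) x -> v x <= 4^-1.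
  move=> sx xn; have := vw _ sx; rewrite wchi; last by left.
  rewrite /chi asboolT// sub0r normrN; exact/le_trans/ler_norm.
have v0 x : ball s r x -> ~ near (c / 4) x -> 3 / 4 <= v x.
  move=> sx xn; have := vw _ sx; rewrite wchi; last by right.
  rewrite /chi asboolF.
    by have := ler_norm (1 - v x); lra.
  by move=> [e Ee ex]; apply: xn; exists e => //; apply: le_ball ex; lra.
pose psi x := if `[< ball s r x >] then smooth_step (v x) else 0.
have psi_in x : ball s r x -> \forall y \near x, smooth_step (v y) = psi y.
  move=> sx; have : \forall y \near x, ball s r y.
    by apply: open_nbhs_nbhs; split => //; exact: ball_open.
  by apply: filterS => y sy; rewrite /psi asboolT.
have psi_supp x : psi x != 0 -> near (c / 4) x.
  rewrite /psi; case: asboolP => [sx|_]; last by rewrite eqxx.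
  by apply: contra_neqP => xn; rewrite smooth_step_ge// v0.
have psi_out x : ~ ball s r x -> \forall y \near x, 0 = psi y.
  move=> sx; near=> y; apply/esym.
  apply: contra_notP sx => /eqP/psi_supp[e Ee ey].
  apply: (Es _ Ee); have : ball x (c / 2) y by near: y; apply: nbhsx_ballx; lra.
  by move: ey; rewrite -!ball_normE /= => ey xy; have := ler_distD y e x;
    rewrite [`|y - x|]distrC; lra.
exists psi; split.
- move=> x; rewrite /psi; case: asboolP => _; first exact: smooth_step_itv.
  by rewrite lexx ler01.
- move=> e x Ee ex.
  have sx : ball s r x by apply: (Es _ Ee); apply: le_ball ex; lra.
  by rewrite /psi asboolT// smooth_step_le// v1//; exists e.
- exact: psi_supp.
- move=> x; have [sx|sx] := pselect (ball s r x); last first.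
    exact: sdiffable_near (psi_out _ sx) (sdiffable_cst (0 : R) x).
  apply: sdiffable_near (psi_in _ sx) _.
  apply: sdiffable_sqpos.
  have sq : sdiffable (fun y => sqpos (2 * v y - 2^-1)) x.
    apply: sdiffable_sqpos.
    apply: (@sdiffableD _ _ _ (fun y => 2 * v y) (cst (- 2^-1))).
      exact: sdiffableM (sdiffable_cst (2 : R) x) (vd _ sx).
    exact: sdiffable_cst.
  have sN := sdiffableM (sdiffable_cst (-1 : R) x) sq.
  apply: sdiffable_near (sdiffableD (sdiffable_cst (1 : R) x) sN).
  by apply: nearW => y; rewrite /= scaleN1r.
- move=> x; have [sx|sx] := pselect (ball s r x); last first.
    apply: lip_at_near (psi_out _ sx) _; apply: lip_atW (lip_at_cst (0 : R) x).
    by apply: divr_ge0; [rewrite !mulr_ge0|exact: ltW].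
  apply: lip_at_near (psi_in _ sx) _.
  have vx : lip_at v x (C1 * (C2 * (8 / c))).
    by apply: lipschitz_lip_at vL; exact: ball_nbhs.
  have tx : lip_at smooth_step (v x) 8.
    by apply: lipschitz_lip_at lipschitz_smooth_step; exact: filterT.
  have <- : 8 * (C1 * (C2 * (8 / c))) = 64 * C1 * C2 / c by ring.
  by apply: lip_at_comp vx tx => //; rewrite mulr_ge0// mulr_ge0.
Unshelve. all: by end_near. Qed.

End Bumps.

(** * Partitions of unity *)

Section PartitionOfUnity.
Context {R : realType}.
Implicit Types X Y : normedModType R.

(** A partition of unity subordinate to the balls [ball s (r s)], [s] in [O].
    The cover may be uncountable, yet the partition is a sequence: the support
    of [phi n] splits into separated pieces, each of them inside one of the
    balls, and [sigma n] tells the centre of that ball.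
    The local Lipschitz constant [L n] of [phi n] does not depend on the
    centres, so that a family of approximations indexed by [n] and [s] can be
    chosen close enough to absorb it. *)
Record partition_of_unity X (O : set X) (r : X -> R)
    (phi : nat -> X -> R) (sigma : nat -> X -> X) (L : nat -> R) : Prop := {
  pou_ge0 : forall n x, 0 <= phi n x;
  pou_sdiffable : forall n x, sdiffable (phi n) x;
  pou_const_ge0 : forall n, 0 <= L n;
  pou_lip_at : forall n x, lip_at (phi n) x (L n);
  pou_supp : forall (n : nat) (x : X), (\forall y \near x, phi n y = 0) \/
    exists2 s, O s & \forall y \near x, ball s (r s) y /\ sigma n y = s;
  pou_sum : forall x : X, O x -> exists N, \forall y \near x,
    (forall n, (N <= n)%N -> phi n y = 0) /\ \sum_(n < N) phi n y = 1
}.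

Definition has_partitions_of_unity X : Prop :=
  forall (O : set X) (r : X -> R), (forall s, O s -> 0 < r s) ->
  exists phi sigma L, partition_of_unity O r phi sigma L.

(** This is Stone's argument for the paracompactness of metric spaces: after
    well-ordering the centres, [E n s] consists of the points at depth
    [n.+1%:R^-1] in the ball of [s] for which [s] is the least possible centre.
    If a point [y] of [E n t] is that close to a point of [E n s], then each
    point lies in the ball of the other's centre, and minimality gives
    [s = t]. *)
Lemma stone_covering X (O : set X) (r : X -> R) : (forall s, O s -> 0 < r s) ->
  exists E : nat -> X -> set X, [/\
    forall n s x, E n s x -> O s /\ ball x n.+1%:R^-1 `<=` ball s (r s),
    forall n s t x y, E n s x -> E n t y -> ball x n.+1%:R^-1 y -> s = t &
    forall x, O x -> exists n s, E n s x].
Proof.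
move=> r0; have [le wo] := wochoice.well_ordering_principle X.
have anti : antisymmetric le.
  have woT : wochoice.wo_chain le predT by move=> A _; exact: wo.
  by move=> x y; apply: (wochoice.wo_chain_antisymmetric woT).
exists (fun n s => [set x | [/\ O s, ball x n.+1%:R^-1 `<=` ball s (r s) &
  forall t, O t -> ball t (r t) x -> le s t]]); split.
- by move=> n s x [].
- move=> n s t x y [Os xs smin] [Ot yt tmin] xy; apply: anti; apply/andP; split.
    by apply: smin => //; apply: yt; exact: ball_sym.
  by apply: tmin => //; exact: xs.
move=> x Ox.
have ne : wochoice.nonempty [pred t | `[< O t /\ ball t (r t) x >] ].
  by exists x; apply/asboolP; split => //; apply: ballxx; exact: r0.
have [s [[sA smin] _]] := wo _ ne.
have /asboolP[Os sx] := sA.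
have /nbhs_ballP[d /= d0 xd] := ball_nbhs sx.
have [n nd] : exists n, n.+1%:R^-1 < d.
  have [n _ H] := near_infty_natSinv_lt (PosNum d0).
  by exists n; exact: (H n (leqnn n)).
exists n, s; split => // [y xy|t Ot tx].
  by apply: xd; apply: le_ball xy; exact: ltW.
by apply: smin; apply/asboolP.
Qed.

(** One bump per piece of the covering above; since the pieces of rank [n] are
    separated and the bumps of rank [n] are supported in small neighbourhoods
    of them, the bumps of rank [n] can be glued into a single function [Psi n].
    The functions are not yet locally finite in [n]. *)
Lemma discrete_bumps X (C1 C2 : R) (O : set X) (r : X -> R) :
  0 <= C1 -> 0 <= C2 -> ball_smoothing X R C1 -> lipschitz_extension X R C2 ->
  (forall s, O s -> 0 < r s) ->
  exists (Psi : nat -> X -> R) (sigma : nat -> X -> X) (K : nat -> R),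
  [/\ forall n, 0 <= K n,
      forall n x, 0 <= Psi n x <= 1,
      forall n x, sdiffable (Psi n) x /\ lip_at (Psi n) x (K n),
      forall (n : nat) (x : X), (\forall y \near x, 0 = Psi n y) \/
        exists2 s, O s & \forall y \near x, ball s (r s) y /\ sigma n y = s &
      forall x : X, O x -> exists n, \forall y \near x, Psi n y = 1].
Proof.
move=> C10 C20 hS hE r0.
have [E [EO Esep Ecov]] := stone_covering r0.
pose c (n : nat) : R := n.+1%:R^-1.
have c0 n : 0 < c n by rewrite invr_gt0.
pose V n s x := exists2 e, E n s e & ball e (c n / 2) x.
have Vuniq n s t x : V n s x -> V n t x -> s = t.
  move=> [e Ee ex] [e' Ee' ex']; apply: (Esep _ _ _ _ _ Ee Ee').
  by rewrite -/(c n) [c n]splitr; apply: ball_triangle ex _; exact: ball_sym.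
pose sigma n x := xget x [set s | V n s x].
have sigmaE n s x : V n s x -> sigma n x = s.
  move=> Vs; have /(xgetPex x) : exists s, V n s x by exists s.
  by move=> /Vuniq; apply.
pose K n := 64 * C1 * C2 / c n.
have K0 n : 0 <= K n.
  by apply: divr_ge0; [rewrite !mulr_ge0|exact: ltW].
have : forall n s, exists psi : X -> R,
   [/\ forall x, 0 <= psi x <= 1,
    forall e x, E n s e -> ball e (c n / 8) x -> psi x = 1,
    forall x, psi x != 0 -> exists2 e, E n s e & ball e (c n / 4) x,
    forall x, sdiffable psi x &
    forall x, lip_at psi x (K n)].
  move=> n s; have [Os|nOs] := pselect (O s).
    apply: (@exists_bump _ _ _ _ _ _ _ _ _ s (r s)) => //; first exact: r0.
    by move=> x /EO[].
  exists (cst 0); split => [x|e x /EO[]//|x||x]; first by rewrite lexx ler01.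
  - by rewrite eqxx.
  - exact: sdiffable_cst.
  - exact: lip_atW (lip_at_cst (0 : R) x).
move=> /choice2[psi psiP].
have psi1 n s e x : E n s e -> ball e (c n / 8) x -> psi n s x = 1.
  by case: (psiP n s) => _ + _ _ _; exact.
have psiN0 n s x : psi n s x != 0 -> exists2 e, E n s e & ball e (c n / 4) x.
  by case: (psiP n s) => _ _ + _ _; exact.
pose Psi n x := psi n (sigma n x) x.
have PsiE (n : nat) (x : X) : (\forall y \near x, 0 = Psi n y) \/
    exists s, [/\ O s, \forall y \near x, ball s (r s) y /\ sigma n y = s &
                  \forall y \near x, psi n s y = Psi n y].
  have [[s [e Ee ex]]|noV] := pselect (exists s, V n s x); [right|left].
    have Vy : \forall y \near x, ball e (c n / 2) y by exact: ball_nbhs.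
    have [Os es] := EO _ _ _ Ee; exists s; split => //.
    - apply: filterS Vy => y ey; split; last by apply: sigmaE; exists e.
      by apply: es; apply: le_ball ey; rewrite -/(c n); have := c0 n; lra.
    - apply: filterS Vy => y ey; rewrite /Psi (_ : sigma n y = s)//.
      by apply: sigmaE; exists e.
  (* the supports have radius c n / 4, so they are at distance at least
     c n / 4 from the points at distance at least c n / 2 from every piece *)
  near=> y; apply/esym; apply: contra_notP noV => /eqP/psiN0[e Ee ey].
  exists (sigma n y); exists e => //.
  have : ball x (c n / 4) y.
    by near: y; apply: nbhsx_ballx; rewrite divr_gt0.
  move: ey; rewrite -!ball_normE /= => ey xy.
  by have := ler_distD y e x; rewrite [`|y - x|]distrC; lra.
exists Psi, sigma, K; split => //.
- by move=> n x; case: (psiP n (sigma n x)) => + _ _ _ _; exact.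
- move=> n x; split.
    have [z|[s [_ _ z]]] := PsiE n x; apply: (sdiffable_near z).
      exact: sdiffable_cst.
    by case: (psiP n s) => _ _ _ + _; exact.
  have [z|[s [_ _ z]]] := PsiE n x; apply: (lip_at_near z).
    exact: lip_atW (lip_at_cst (0 : R) x).
  by case: (psiP n s) => _ _ _ _; exact.
- move=> n x; have [z|[s [Os z _]]] := PsiE n x; first by left.
  by right; exists s.
- move=> x /Ecov[n [s nE]]; exists n.
  have xn : 0 < c n / 8 by rewrite divr_gt0.
  near=> y; have xy : ball x (c n / 8) y by near: y; exact: nbhsx_ballx.
  rewrite /Psi (_ : sigma n y = s); first exact: psi1 nE xy.
  by apply: sigmaE; exists x => //; apply: le_ball xy; have := c0 n; lra.
Unshelve. all: by end_near. Qed.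

(** The products [P n] of the [1 - Psi m], [m < n], turn the bumps into a
    partition of unity: with [phi n = P n * Psi n] the sums telescope to
    [1 - P N], and [P N] vanishes near [x] as soon as some [Psi n] with [n < N]
    is constantly [1] there. *)
Lemma exists_partition_of_unity X (C1 : R) :
  0 <= C1 -> ball_smoothing X R C1 -> property_LE X R ->
  has_partitions_of_unity X.
Proof.
move=> C10 hS [C2 C20 hE] O r r0.
have [Psi [sigma [K [K0 Psi01 Psid PsiE Psi1]]]] :=
  discrete_bumps C10 (ltW C20) hS hE r0.
pose P n x := \prod_(m < n) (1 - Psi m x).
have P01 n x : 0 <= P n x <= 1.
  rewrite prodr_ge0 /=.
    by apply: prodr_ile1 => i _; have /andP[] := Psi01 i x; lra.
  by move=> i _; have /andP[] := Psi01 i x; lra.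
have PS n x : P n.+1 x = P n x * (1 - Psi n x) by rewrite /P big_ord_recr.
have NPsid n x : sdiffable (fun y => 1 - Psi n y) x.
  apply: sdiffable_near (sdiffableD (sdiffable_cst (1 : R) x)
    (sdiffableM (sdiffable_cst (-1 : R) x) (Psid n x).1)).
  by apply: nearW => y; rewrite /= scaleN1r.
have Pd n x : sdiffable (P n) x.
  elim: n => [|n IH].
    apply: sdiffable_near (sdiffable_cst (1 : R) x).
    by apply: nearW => y; rewrite /P big_ord0.
  apply: sdiffable_near (sdiffableM IH (NPsid n x)).
  by apply: nearW => y; rewrite PS.
have lipM01 (u w : X -> R) x a b : 0 <= u x <= 1 -> 0 <= w x <= 1 ->
    0 <= a -> 0 <= b -> lip_at u x a -> lip_at w x b ->
    lip_at (fun y => u y * w y) x (a + b).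
  move=> /andP[u0 u1] /andP[w0 w1] a0 b0 ua wb.
  apply: lip_atW (lip_atM a0 b0 ua wb).
  by rewrite !ger0_norm// addrC lerD// ?ler_piMl// ler_piMr.
pose L n := \sum_(m < n) K m.
have L0 n : 0 <= L n by apply: sumr_ge0.
have PL n x : lip_at (P n) x (L n).
  elim: n => [|n IH].
    rewrite /L big_ord0; apply: lip_at_near (lip_at_cst (1 : R) x).
    by apply: nearW => y; rewrite /P big_ord0.
  rewrite /L big_ord_recr /=.
  have h : lip_at (fun y => P n y * (1 - Psi n y)) x (L n + K n).
    apply: lipM01 => //.
      by have /andP[] := Psi01 n x; lra.
    by have := lip_atB (lip_at_cst (1 : R) x) (Psid n x).2; rewrite add0r.
  by apply: lip_at_near h; apply: nearW => y; rewrite PS.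
exists (fun n x => P n x * Psi n x), sigma, (fun n => L n.+1); split.
- move=> n x; have /andP[a _] := P01 n x; have /andP[b _] := Psi01 n x.
  exact: mulr_ge0.
- by move=> n x; exact: sdiffableM (Pd n x) (Psid n x).1.
- by [].
- move=> n x; rewrite /L big_ord_recr /=.
  exact: (lipM01 _ _ _ _ _ (P01 n x) (Psi01 n x) (L0 n) (K0 n) (PL n x)
    (Psid n x).2).
- move=> n x; have [z|[s Os z]] := PsiE n x; [left|right; exists s => //].
  by apply: filterS z => y <-; rewrite mulr0.
- move=> x /Psi1[n xn]; exists n.+1; apply: filterS xn => y yn.
  have P0 m : (n < m)%N -> P m y = 0.
    by move=> nm; rewrite /P (bigD1 (Ordinal nm)) //= yn subrr mul0r.
  split; first by move=> m nm; rewrite P0// mul0r.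
  have tel N : \sum_(m < N) P m y * Psi m y = 1 - P N y.
    elim: N => [|N IH]; first by rewrite /P !big_ord0 subrr.
    by rewrite big_ord_recr /= IH PS; ring.
  by rewrite tel P0// subr0.
Qed.

End PartitionOfUnity.

(** * Gluing with a partition of unity *)

Section Gluing.
Context {R : realType}.
Implicit Types X Y : normedModType R.

(** [g] is the sum of the [phi n *: k n s], where [s = sigma n y] is locally
    constant on the support of [phi n]; the sum is expressed by a single finite
    index bound [N] around [x]. *)
Definition glued_at X Y (phi : nat -> X -> R) (sigma : nat -> X -> X)
    (k : nat -> X -> X -> Y) (g : X -> Y) (x : X) : Prop :=
  exists N, \forall y \near x,
    g y = \sum_(n < N) phi n y *: k n (sigma n y) y /\
    \sum_(n < N) phi n y = 1.

Lemma pou_glue X Y (O : set X) (r : X -> R) phi sigma L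
    (k : nat -> X -> X -> Y) : partition_of_unity O r phi sigma L ->
  exists g : X -> Y, forall x : X, O x -> glued_at phi sigma k g x.
Proof.
move=> pou.
have /choice[N NP] : forall x : X, exists N,
    (exists M, forall n, (M <= n)%N -> phi n x = 0) ->
    forall n, (N <= n)%N -> phi n x = 0.
  move=> x.
  have [[M xM]|nM] := pselect (exists M, forall n, (M <= n)%N -> phi n x = 0).
    by exists M.
  by exists 0%N.
exists (fun y => \sum_(n < N y) phi n y *: k n (sigma n y) y) => x Ox.
have [M xM] := pou_sum pou Ox; exists M.
apply: filterS xM => y [yM ->]; split => //.
have stab a b : (a <= b)%N -> (forall n, (a <= n)%N -> phi n y = 0) ->
    \sum_(n < b) phi n y *: k n (sigma n y) y =
    \sum_(n < a) phi n y *: k n (sigma n y) y.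
  move=> /subnKC <- ya; elim: (b - a)%N => [|d IH]; first by rewrite addn0.
  by rewrite addnS big_ord_recr /= IH ya ?leq_addr// scale0r addr0.
have yN := NP y (ex_intro _ M yM).
have [NM|/ltnW MN] := leqP (N y) M; first by rewrite -(stab _ _ NM).
by rewrite (stab _ _ MN).
Qed.

(** Local properties stable under sums pass from the terms [phi n *: k n s],
    with [s] fixed, to the glued mapping. *)
Lemma glue_ind X Y (O : set X) (r : X -> R) phi sigma L
    (k : nat -> X -> X -> Y) (g : X -> Y) x (P : (X -> Y) -> Prop) :
  partition_of_unity O r phi sigma L ->
  glued_at phi sigma k g x ->
  (forall u w, (\forall y \near x, u y = w y) -> P u -> P w) ->
  P (cst 0) -> (forall u w, P u -> P w -> P (u \+ w)) ->
  (forall n s, O s -> ball s (r s) x -> P (fun y => phi n y *: k n s y)) ->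
  P g.
Proof.
move=> pou [N gN] Pnear P0 PD Pk.
have Pt n : P (fun y => phi n y *: k n (sigma n y) y).
  have [z|[s Os z]] := pou_supp pou n x.
    by apply: Pnear P0; apply: filterS z => y ->; rewrite scale0r.
  apply: Pnear (Pk n s Os _); last by case: (nbhs_singleton z).
  by apply: filterS z => y [_ ->].
have PS M : P (fun y => \sum_(n < M) phi n y *: k n (sigma n y) y).
  elim: M => [|M IH].
    by apply: Pnear P0; apply: nearW => y; rewrite big_ord0.
  apply: Pnear (PD _ _ IH (Pt M)).
  by apply: nearW => y; rewrite big_ord_recr.
by apply: Pnear (PS N); apply: filterS gN => y [->].
Qed.

(** As the [phi n] sum to [1], [g - F] is locally the sum of the
    [phi n *: (k n s - F)]. By the Leibniz rule the local Lipschitz constant of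
    a term is at most [phi n x * c] plus the product of that of [phi n] with the
    error [k n s x - F x]; the latter is summable by assumption. *)
Lemma glue_lip_at X Y (O : set X) (r : X -> R) phi sigma L
    (k : nat -> X -> X -> Y) (g F : X -> Y) x (c e : R) :
  partition_of_unity O r phi sigma L ->
  glued_at phi sigma k g x ->
  0 <= c -> 0 <= e ->
  (forall n s, O s -> ball s (r s) x -> lip_at (k n s \- F) x c /\
     L n * `|k n s x - F x| <= e / 2 ^+ n.+1) ->
  lip_at (g \- F) x (c + e).
Proof.
move=> pou [N gN] c0 e0 kF.
pose h n y := phi n y *: (k n (sigma n y) y - F y).
have hL n : lip_at (h n) x (phi n x * c + e / 2 ^+ n.+1).
  have e2 : 0 <= e / 2 ^+ n.+1 by rewrite divr_ge0.
  have [z|[s Os z]] := pou_supp pou n x.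
    apply: (@lip_at_near _ _ _ (cst 0)).
      by apply: filterS z => y z; rewrite /h z scale0r.
    apply: lip_atW (lip_at_cst (0 : Y) x).
    by rewrite addr_ge0// mulr_ge0// (pou_ge0 pou).
  have [sx _] := nbhs_singleton z; have [k1 k2] := kF n s Os sx.
  have := lip_atM (pou_const_ge0 pou n) c0 (pou_lip_at pou n x) k1.
  move=> /(lip_at_near _) H.
  have {}H := H (h n) _.
  apply: lip_atW (H _).
    by rewrite ger0_norm ?(pou_ge0 pou)// lerD2l.
  by apply: filterS z => y [_ zy]; rewrite /h zy.
have S1 : \sum_(n < N) phi n x = 1 by case: (nbhs_singleton gN).
have S2 M : \sum_(n < M) e / 2 ^+ n.+1 = e - e / 2 ^+ M.
  elim: M => [|M IH]; first by rewrite big_ord0 expr0 divr1 subrr.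
  rewrite big_ord_recr /= IH exprS; field.
  by rewrite expf_neq0.
apply: (@lip_at_near _ _ _ (fun y => \sum_(n < N) h n y)).
  apply: filterS gN => y [gy S].
  by rewrite /= gy /h -[F y in RHS]scale1r -S scaler_suml -sumrB;
    apply: eq_bigr => n _; rewrite scalerBr.
apply: lip_atW (lip_at_sum _ (fun n : 'I_N => hL n)).
rewrite big_split /= -mulr_suml S1 mul1r S2 lerD2l gerBl divr_ge0//.
Qed.

Definition locally_lipschitz_at X Y (f : X -> Y) x :=
  exists2 c, 0 <= c & lip_at f x c.

Lemma locally_lipschitz_at_near X Y (f g : X -> Y) x :
  (\forall y \near x, f y = g y) ->
  locally_lipschitz_at f x -> locally_lipschitz_at g x.
Proof. by move=> fg [c c0 fx]; exists c => //; apply: lip_at_near fx. Qed.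

Lemma locally_lipschitz_atD X Y (f g : X -> Y) x :
  locally_lipschitz_at f x -> locally_lipschitz_at g x ->
  locally_lipschitz_at (f \+ g) x.
Proof.
move=> [c c0 fx] [d d0 gx]; exists (c + d); first exact: addr_ge0.
exact: lip_atD.
Qed.

End Gluing.

(** * An extension strictly differentiable on the set *)

Section StrictExtension.
Context {R : realType}.
Implicit Types X Y : normedModType R.

Lemma within_near X (A P : set X) x : A x ->
  (\forall y \near (x : subspace A), P y) ->
  exists2 d, 0 < d & forall y, ball x d y -> A y -> P y.
Proof.
move=> Ax xP; have : within A (nbhs x) P by rewrite (nbhs_subspace_in Ax).
by move=> /nbhs_ballP[d d0 H]; exists d => // y xy Ay; exact: H.
Qed.

Lemma condition_W_ball X Y (A : set X) (f : X -> Y) (G : X -> lcfun X Y)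
    (s : X) (e : R) :
  condition_W A f G -> A s -> 0 < e ->
  exists2 d, 0 < d & e.-lipschitz_(ball s d `&` A) (f \- G s) /\
    forall a, ball s d a -> A a -> opnorm (G s - G a) <= e.
Proof.
move=> [Gc fG] As e0.
have [d d0 H] := fG s As e e0.
have : \forall y \near (s : subspace A), opnorm (G s - G y) <= e.
  by have /cvgrPdist_le/(_ _ e0) := Gc s.
move=> /(within_near As)[d' d'0 H'].
exists (Num.min d d'); first by rewrite lt_min d0.
split; last first.
  by move=> a sa; apply: H'; apply: le_ball sa; rewrite ge_min lexx orbT.
apply/lipschitzP => y z [sy Ay] [sz Az] /=.
have b w : ball s (Num.min d d') w -> ball s d w.
  by apply: le_ball; rewrite ge_min lexx.
have := H z y (conj (b _ sz) Az) (conj (b _ sy) Ay).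
by rewrite (linearB (G s)) /= !opprD !opprK addrACA.
Qed.

(** The local extensions [k s] of [f], obtained from the (LE)-extension of
    [f - G s] for [s] in [A] (and equal to [0] elsewhere), all take the value
    [f a] at a point [a] of [A] in the ball of [s]. So the derivatives of the
    partition of unity do not contribute at [a]. *)
Lemma rough_extension X Y (C e : R) (O A : set X) (f : X -> Y)
    (G : X -> lcfun X Y) :
  0 <= C -> lipschitz_extension X Y C ->
  has_partitions_of_unity X ->
  A `<=` O -> (forall x, O x -> ~ A x -> \forall y \near x, ~ A y) ->
  condition_W A f G -> 0 < e ->
  exists F : X -> Y, [/\ forall a, A a -> F a = f a,
    forall a, A a -> lip_at (F \- G a) a e &
    forall x, O x -> locally_lipschitz_at F x].
Proof.
move=> C0 hE hP AO Acl W e0.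
(* the extension of f - G s contributes C * d, the oscillation of G adds d *)
pose d := e / (C + 1).
have C1 : 0 < C + 1 by rewrite ltr_wpDl.
have d0 : 0 < d by rewrite divr_gt0.
have : forall s : X, exists r k, O s -> [/\ 0 < r,
    forall a, A a -> ball s r a -> k a = f a /\ lip_at (k \- G a) a e &
    forall x, locally_lipschitz_at k x].
  move=> s; have [As|nAs] := pselect (A s); last first.
    have [Os|nOs] := pselect (O s); last by exists 0, (cst 0).
    have /nbhs_ballP[r r0 sr] := Acl _ Os nAs.
    exists r, (cst 0) => _; split => //= [a Aa /sr//|x].
    by exists 0 => //; exact: lip_at_cst.
  have [r r0 [fL GL]] := condition_W_ball W As d0.
  have [w /lipschitzP wL wf] := hE _ _ _ (ltW d0) fL.
  exists r, (w \+ G s) => _; split => //= [a Aa sa|x].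
    split; first by rewrite wf//= subrK.
    have wa : lip_at w a (C * d).
      apply: (@lipschitz_lip_at _ _ _ _ setT); first exact: filterT.
      exact/lipschitzP.
    have Ga := lip_at_lcfun (G s - G a) a.
    apply: (@lip_at_near _ _ _ (w \+ (G s - G a))).
      by apply: nearW => y /=; rewrite -addrA.
    apply: lip_atW (lip_atD wa Ga).
    rewrite (_ : e = C * d + d); first by rewrite lerD2l GL.
    by rewrite /d; field; rewrite gt_eqF.
  exists (C * d + opnorm (G s)).
    by rewrite addr_ge0 ?opnorm_ge0// mulr_ge0// ltW.
  apply: lip_atD; last exact: lip_at_lcfun.
  by apply: (@lipschitz_lip_at _ _ _ _ setT); [exact: filterT|exact/lipschitzP].
move=> /choice[r /choice[k rkP]].
have [|phi [sigma [L pou]]] := hP O r.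
  by move=> s /rkP[].
have [F FP] := pou_glue (fun=> k) pou.
have Fa a : A a -> F a = f a.
  move=> Aa; have [N aN] := FP a (AO _ Aa).
  have [-> S] := nbhs_singleton aN; rewrite -[RHS]scale1r -S scaler_suml.
  apply: eq_bigr => n _; have [z|[s Os z]] := pou_supp pou n a.
    by rewrite (nbhs_singleton z) !scale0r.
  have [sa ->] := nbhs_singleton z; congr (_ *: _).
  by have [_ /(_ a Aa sa)[]] := rkP _ Os.
exists F; split => // [a Aa|x Ox].
  pose T y := G a y + (f a - G a a).
  have TE (h : X -> Y) y : (h \- T) y = (h \- G a) y - (f a - G a a).
    by rewrite /= /T opprD addrA.
  have : lip_at (F \- T) a (e + 0).
    apply: (glue_lip_at pou (FP a (AO _ Aa))) (ltW e0) (lexx 0) _ => n s Os sa.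
    have [_ /(_ a Aa sa)[sE sL] _] := rkP _ Os; split.
      have := lip_atB sL (lip_at_cst (f a - G a a) a); rewrite addr0.
      by apply: lip_at_near; apply: nearW => y; rewrite TE.
    by rewrite /= sE /T [G a a + _]addrC subrK subrr normr0 mulr0 mul0r.
  rewrite addr0 => h.
  have := lip_atD h (lip_at_cst (f a - G a a) a); rewrite addr0.
  apply: lip_at_near; apply: nearW => y.
  by rewrite [LHS]/= [X in X + _]TE subrK.
apply: (@glue_ind _ _ _ _ _ _ _ _ _ F x (@locally_lipschitz_at R X Y ^~ x) pou
  (FP x Ox)).
- by move=> u w; exact: locally_lipschitz_at_near.
- by exists 0 => //; exact: lip_at_cst.
- by move=> u w; exact: locally_lipschitz_atD.
- move=> n s Os sx; have [_ _ /(_ x)[c c0 xc]] := rkP _ Os.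
  exists (`|phi n x| * c + L n * `|k s x|).
    by rewrite addr_ge0// mulr_ge0//; exact: (pou_const_ge0 pou).
  exact: lip_atM (pou_const_ge0 pou n) c0 (pou_lip_at pou n x) xc.
Qed.

(** Vanishing at a common point [a] turns the Lipschitz bounds into pointwise
    bounds, whence convergence; the remainders inherit the Lipschitz bounds. *)
Lemma lipschitz_series X (Y : completeNormedModType R) (a : X) (K : R)
    (E : nat -> X -> Y) : 0 <= K ->
  (forall n, (K / 2 ^+ n).-lipschitz (E n)) -> (forall n, E n a = 0) ->
  exists H : X -> Y, (forall x, (forall n, E n x = 0) -> H x = 0) /\
    forall N, (2 * K / 2 ^+ N).-lipschitz (fun x => H x - \sum_(n < N) E n x).
Proof.
move=> K0 EL Ea.
have cv x : cvgn (series (fun n => E n x)).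
  apply: normed_cvg.
  have half : `|2^-1| < 1 :> R by rewrite ger0_norm// invf_lt1// ltr1n.
  have := is_cvg_geometric_series (a := K * `|x - a|) half.
  apply: series_le_cvg => n /=.
  - by [].
  - by rewrite mulr_ge0// mulr_ge0.
  - have /lipschitzP/(_ x a I I) := EL n.
    by rewrite Ea subr0 exprVn mulrAC.
exists (fun x => limn (series (fun n => E n x))); split.
  move=> x Ex; rewrite (_ : series _ = fun=> 0) ?lim_cst//.
  by apply/funext => n; rewrite seriesEord /= big1.
have fin N d x y :
    `|\sum_(N <= n < N + d) E n x - \sum_(N <= n < N + d) E n y| <=
    (2 * K / 2 ^+ N - 2 * K / 2 ^+ (N + d)) * `|x - y|.
  elim: d => [|d IH].
    by rewrite addn0 !big_geq// !subrr normr0 mul0r.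
  rewrite addnS !big_nat_recr ?leq_addr//= opprD addrACA.
  apply: le_trans (ler_normD _ _) _.
  have /lipschitzP/(_ x y I I) EN := EL (N + d)%N.
  apply: le_trans (lerD IH EN) _; rewrite -mulrDl ler_wpM2r// exprS.
  rewrite -addrA lerD2l.
  suff -> : K / 2 ^+ (N + d) =
      2 * K / 2 ^+ (N + d) - 2 * K / (2 * 2 ^+ (N + d)).
    by rewrite addKr.
  by field; rewrite expf_neq0.
move=> N; apply/lipschitzP => x y _ _.
have cvN z : (fun M => \sum_(N <= n < M) E n z) @ \oo -->
    limn (series (fun n => E n z)) - \sum_(n < N) E n z.
  have : (fun M => series (fun n => E n z) M - \sum_(n < N) E n z) @ \oo -->
    limn (series (fun n => E n z)) - \sum_(n < N) E n z.
    by apply: cvgB; [exact: cv|exact: cvg_cst].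
  apply: cvg_trans; apply: near_eq_cvg; near=> M.
  have NM : (N <= M)%N by near: M; exact: nbhs_infty_ge.
  rewrite (_ : series _ M = \sum_(N <= n < M) E n z + \sum_(n < N) E n z).
    by rewrite addrK.
  by rewrite /series /= (@big_cat_nat _ _ _ N)//= addrC big_mkord.
apply: (cvgr_to_le (cvg_norm (cvgB (cvN x) (cvN y)))).
near=> M; have NM : (N <= M)%N by near: M; exact: nbhs_infty_ge.
rewrite -(subnKC NM); apply: le_trans (fin _ _ _ _) _.
by rewrite ler_wpM2r// gerBl divr_ge0// mulr_ge0.
Unshelve. all: by end_near. Qed.

(** [E] is [kap]-Lipschitz on the set [S] of the points [x] that are four times
    closer to some [a] in [A] than the radius [d] of a ball around [a] where [E]
    is [kap]-Lipschitz. For two points of [S], either one of these balls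
    contains both, or their distance dominates their distances to [A], where [E]
    vanishes. Then extend [E] from [S]. *)
Lemma germ_extension X Y (C kap : R) (A : set X) (E : X -> Y) : 0 <= kap ->
  lipschitz_extension X Y C -> (forall a, A a -> E a = 0) ->
  (forall a, A a -> exists2 d, 0 < d & kap.-lipschitz_(ball a d) E) ->
  exists2 E' : X -> Y, (C * kap).-lipschitz E' &
    forall a, A a -> \forall y \near a, E' y = E y.
Proof.
move=> k0 hE E0 EA.
pose S x := exists a d,
  [/\ A a, 0 < d, kap.-lipschitz_(ball a d) E & ball a (d / 4) x].
have SL : kap.-lipschitz_S E.
  have far x y a d : A a -> 0 < d -> kap.-lipschitz_(ball a d) E ->
      ball a (d / 4) x ->
      ball a d y \/ `|E x| <= kap * (`|x - y| / 2).
    move=> Aa d0 /lipschitzP EL ax.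
    have [ay|nay] := pselect (ball a d y); [by left|right].
    have ax' : ball a d x by apply: le_ball ax; lra.
    have := EL _ _ ax' (ballxx a d0).
    rewrite (E0 _ Aa) subr0 => /le_trans; apply.
    rewrite ler_wpM2l//; move: nay ax; rewrite -!ball_normE /= => /negP.
    rewrite -leNgt [`|x - a|]distrC => nay ax.
    by have := ler_distD x a y; lra.
  apply/lipschitzP => x y [a [d [Aa d0 EL ax]]] [b [r [Ab r0 EL' bry]]].
  have [ay|hx] := far x y _ _ Aa d0 EL ax.
    have ax' : ball a d x by apply: le_ball ax; lra.
    by move/lipschitzP : EL; apply.
  have [bx|hy] := far y x _ _ Ab r0 EL' bry.
    have bry' : ball b r y by apply: le_ball bry; lra.
    by move/lipschitzP : EL'; apply.
  apply: le_trans (ler_normB _ _) _; rewrite [`|y - x|]distrC in hy.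
  by apply: le_trans (lerD hx hy) _; rewrite -mulrDr -splitr.
have [E' E'L E'E] := hE _ _ _ k0 SL; exists E' => // a Aa.
have [d d0 EL] := EA _ Aa.
have d40 : 0 < d / 4 by rewrite divr_gt0.
by apply: filterS (nbhsx_ballx a _ d40) => y ay; apply: E'E; exists a, d.
Qed.

(** With [F n] the rough extension for [2^-n] and [E n] a global mapping with
    the germ of [F n.+1 - F n] along [A], the sum of [F 0] and of the [E n] is,
    near a point of [A], [F N] plus a remainder of Lipschitz constant of order
    [2^-N]. *)
Lemma strict_extension X (Y : completeNormedModType R) (C : R) (O A : set X)
    (f : X -> Y) (G : X -> lcfun X Y) :
  0 <= C -> lipschitz_extension X Y C ->
  has_partitions_of_unity X ->
  A `<=` O -> (forall x, O x -> ~ A x -> \forall y \near x, ~ A y) ->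
  condition_W A f G -> A !=set0 ->
  exists F : X -> Y, [/\ forall a, A a -> F a = f a,
    forall a, A a -> sdiff F a (G a) &
    forall x, O x -> locally_lipschitz_at F x].
Proof.
move=> C0 hE hP AO Acl W [a0 Aa0].
have /choice[F FP] : forall n : nat, exists F : X -> Y,
    [/\ forall a, A a -> F a = f a,
      forall a, A a -> lip_at (F \- G a) a (2 ^+ n)^-1 &
      forall x, O x -> locally_lipschitz_at F x].
  move=> n; apply: (rough_extension C0 hE hP AO Acl W).
  by rewrite invr_gt0 exprn_gt0.
have /choice[E EP] : forall n : nat, exists E : X -> Y,
    (C * 2 / 2 ^+ n).-lipschitz E /\
    forall a, A a -> \forall y \near a, E y = F n.+1 y - F n y.
  move=> n; have [F0 F1 _] := FP n; have [F0' F1' _] := FP n.+1.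
  have k0 : 0 <= 2 / 2 ^+ n :> R by rewrite divr_ge0.
  have [||E EL EE] :=
    @germ_extension _ _ C (2 / 2 ^+ n) A (F n.+1 \- F n) k0 hE.
  - by move=> a Aa /=; rewrite F0// F0'// subrr.
  - move=> a Aa; have h := lip_atB (F1' _ Aa) (F1 _ Aa).
    have : lip_at (F n.+1 \- F n) a ((2 ^+ n.+1)^-1 + (2 ^+ n)^-1).
      by apply: lip_at_near h; apply: nearW => y /=; rewrite opprB addrA subrK.
    move/lip_at_ball; apply; rewrite exprS.
    have : 0 < (2 ^+ n)^-1 :> R by rewrite invr_gt0 exprn_gt0.
    by rewrite invfM; lra.
  by exists E; split => // ; rewrite mulrA in EL.
have Ea n a : A a -> E n a = 0.
  move=> Aa; rewrite (nbhs_singleton ((EP n).2 _ Aa)).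
  by have [-> //] := FP n; have [-> //] := FP n.+1; rewrite subrr.
have [H [H0 HL]] := @lipschitz_series _ _ a0 (C * 2) E (mulr_ge0 C0 (ler0n R 2))
  (fun n => (EP n).1) (fun n => Ea n a0 Aa0).
exists (F 0%N \+ H); split.
- move=> a Aa /=; rewrite H0 ?addr0; first by have [->] := FP 0%N.
  by move=> n; exact: Ea.
- move=> a Aa; apply: lip_at_inf => e e0; rewrite add0r.
  have [N Ne] : exists N, (1 + 2 * (C * 2)) / 2 ^+ N < e.
    have K0 : 0 < 1 + 2 * (C * 2) by rewrite ltr_wpDr// !mulr_ge0.
    have eK : 0 < e / (1 + 2 * (C * 2)) by rewrite divr_gt0.
    have [N _ HN] := near_infty_natSinv_expn_lt (PosNum eK).
    exists N; have := HN N (leqnn N); rewrite /= div1r ltr_pdivlMr//.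
    by rewrite mulrC.
  have SE M : \forall y \near a, \sum_(n < M) E n y = F M y - F 0%N y.
    elim: M => [|M IH]; first by apply: nearW => y; rewrite big_ord0 subrr.
    apply: filterS2 IH ((EP M).2 _ Aa) => y IH EM.
    by rewrite big_ord_recr /= IH EM addrC addrA subrK.
  have HN : lip_at (fun x => H x - \sum_(n < N) E n x) a (2 * (C * 2) / 2 ^+ N).
    by apply: (@lipschitz_lip_at _ _ _ _ setT); [exact: filterT|exact: HL].
  have [_ /(_ a Aa) FN _] := FP N.
  apply: (@lip_atW _ _ _ _ _ ((2 ^+ N)^-1 + 2 * (C * 2) / 2 ^+ N)).
    by apply: ltW; apply: le_lt_trans Ne; rewrite [leRHS]mulrDl mul1r.
  apply: lip_at_near (lip_atD FN HN); apply: filterS (SE N) => y Sy /=.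
  rewrite Sy opprB !addrA [LHS](ACl ((1*5)*(4*3)*2)) /=.
  by rewrite subrr add0r.
- move=> x Ox; apply: locally_lipschitz_atD.
    by have [_ _ /(_ _ Ox)] := FP 0%N.
  exists (2 * (C * 2) / 2 ^+ 0); first by rewrite divr_ge0// !mulr_ge0.
  apply: (@lipschitz_lip_at _ _ _ _ setT); first exact: filterT.
  have := HL 0%N; congr (_.-lipschitz_setT _); apply/funext => y.
  by rewrite big_ord0 subr0.
Qed.

End StrictExtension.

(** * Smoothing the extension off the set *)

Section SmoothApproximation.
Context {R : realType}.
Implicit Types X Y : normedModType R.

(** On the ball of [s], [k n s] is [T] plus a smoothing of [F - T]. Its error is
    at most [eta s / 2^(n+1)] divided by [1 + L n], where [L n] bounds the local
    Lipschitz constant of the [n]-th function of the partition of unity; so the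
    derivatives of the partition cost at most [eta s] altogether. *)
Lemma smooth_approximation X Y (C : R) (O : set X) (F : X -> Y)
    (r kap eta : X -> R) :
  0 <= C -> ball_smoothing X Y C ->
  has_partitions_of_unity X ->
  (forall s, O s -> [/\ 0 < r s, 0 <= kap s, 0 < eta s &
     exists T : lcfun X Y, (kap s).-lipschitz_(ball s (r s)) (F \- T)]) ->
  exists g : X -> Y, [/\ forall x, O x -> sdiffable g x,
    forall x e, O x -> 0 <= e ->
      (forall s, O s -> ball s (r s) x -> eta s <= e) -> `|g x - F x| <= e &
    forall x e, O x -> 0 <= e ->
      (forall s, O s -> ball s (r s) x -> kap s <= e /\ eta s <= e) ->
      lip_at (g \- F) x ((C + 2) * e)].
Proof.
move=> C0 hS hP rke.
have [|phi [sigma [L pou]]] := hP O r; first by move=> s /rke[].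
have L1 n : 0 < 1 + L n by rewrite ltr_pwDl//; exact: (pou_const_ge0 pou).
have : forall n s, exists k : X -> Y, O s ->
    forall x, ball s (r s) x -> [/\ sdiffable k x,
      lip_at (k \- F) x ((C + 1) * kap s) &
      `|k x - F x| <= eta s / (2 ^+ n.+1 * (1 + L n))].
  move=> n s; have [Os|nOs] := pselect (O s); last by exists (cst 0).
  have [r0 k0 e0 [T TL]] := rke _ Os.
  have d0 : 0 < eta s / (2 ^+ n.+1 * (1 + L n)).
    by rewrite divr_gt0// mulr_gt0// exprn_gt0.
  have [v [vL vd uv]] := hS _ _ _ _ _ r0 k0 TL d0.
  exists (T \+ v) => _ x sx; have sx' := ball_nbhs sx; split.
  - by apply: sdiffableD; [exact: sdiffable_lcfun|exact: vd].
  - have := lip_atB (lipschitz_lip_at sx' vL) (lipschitz_lip_at sx' TL).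
    rewrite mulrDl mul1r; apply: lip_at_near; apply: nearW => y /=.
    by rewrite opprB addrA [T y + v y]addrC.
  - by have := uv _ sx; rewrite distrC /= opprB addrA [T x + v x]addrC.
move=> /choice2[k kP].
have [g gP] := pou_glue k pou; exists g; split.
- move=> x Ox.
  apply: (@glue_ind _ _ _ _ _ _ _ _ _ g x (@sdiffable R X Y ^~ x) pou
    (gP x Ox)).
  + by move=> u w; exact: sdiffable_near.
  + exact: sdiffable_cst.
  + by move=> u w; exact: sdiffableD.
  + move=> n s Os sx; apply: sdiffableM; first exact: (pou_sdiffable pou).
    by case: (kP n s Os x sx).
- move=> x e Ox e0 He; have [N xN] := gP x Ox.
  have [-> S] := nbhs_singleton xN.
  rewrite -[F x]scale1r -S scaler_suml -sumrB.
  apply: le_trans (ler_norm_sum _ _ _) _.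
  rewrite -[leRHS]mul1r -S mulr_suml; apply: ler_sum => n _.
  rewrite -scalerBr normrZ ger0_norm ?(pou_ge0 pou)//.
  have [z|[s Os z]] := pou_supp pou n x.
    by rewrite (nbhs_singleton z) !mul0r.
  have [sx ->] := nbhs_singleton z; rewrite ler_wpM2l ?(pou_ge0 pou)//.
  have [_ _ h] := kP n s Os x sx; apply: le_trans h _.
  have [_ _ eta0 _] := rke _ Os.
  apply: le_trans (He s Os sx); rewrite ler_piMr ?(ltW eta0)// invf_le1.
    by rewrite mulr_ege1// ?exprn_ege1 ?ler1n// lerDl (pou_const_ge0 pou).
  by rewrite mulr_gt0// exprn_gt0.
- move=> x e Ox e0 He.
  rewrite (_ : (C + 2) * e = (C + 1) * e + e); last by ring.
  apply: (glue_lip_at pou (gP x Ox)) => //.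
    by rewrite mulr_ge0// addr_ge0.
  move=> n s Os sx; have [_ k1 k2] := kP n s Os x sx.
  have [ke ee] := He s Os sx; have [_ _ eta0 _] := rke _ Os; split.
    by apply: lip_atW k1; rewrite ler_wpM2l// addr_ge0.
  apply: le_trans (ler_wpM2l (pou_const_ge0 pou n) k2) _.
  have p0 : 0 < 2 ^+ n.+1 :> R by rewrite exprn_gt0.
  have -> : L n * (eta s / (2 ^+ n.+1 * (1 + L n))) =
      L n / (1 + L n) * (eta s / 2 ^+ n.+1) by field; rewrite !gt_eqF.
  apply: (@le_trans _ _ (eta s / 2 ^+ n.+1)).
    rewrite ler_piMl ?divr_ge0 ?(ltW eta0)//.
    by rewrite ler_pdivrMr// mul1r lerDr.
  by rewrite ler_pM2r ?invr_gt0.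
Qed.

Lemma C1_on_cst0 X Y (O : set X) : C1_on O (cst (0 : Y)).
Proof.
exists (fun=> 0) => [x _|]; first exact: is_diff_cst.
by apply: continuous_subspaceT => x; exact: cvg_cst.
Qed.

(** [kap] is within [2 * rho] of the infimum of the local Lipschitz constants of
    [F - T] at [s] over all linear [T], and [rho] measures the distance of [s]
    to [A] from below. *)
Lemma near_best_scale X Y (F : X -> Y) (A : set X) (s : X) :
  locally_lipschitz_at F s -> (\forall y \near s, ~ A y) ->
  exists r kap rho : R, [/\ 0 < r <= rho, 0 <= kap, 0 < rho <= 1 &
    [/\ exists T : lcfun X Y, kap.-lipschitz_(ball s r) (F \- T),
    forall a, A a -> 2 * rho <= `|s - a| &
    forall (T : lcfun X Y) c, 0 <= c -> lip_at (F \- T) s c ->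
      kap <= c + 2 * rho]].
Proof.
move=> [c0 c00 Fc0] /nbhs_ballP[d d0 sA].
pose rho := Num.min 1 (d / 2).
have rho0 : 0 < rho by rewrite lt_min ltr01 divr_gt0.
pose S := [set c : R | 0 <= c /\ exists T : lcfun X Y, lip_at (F \- T) s c].
have Sinf : has_inf S.
  split; last by exists 0 => c [].
  exists c0; split => //; exists 0; apply: lip_at_near Fc0.
  by apply: nearW => y /=; rewrite subr0.
have [c [c1 [T Tc]] cS] := inf_adherent rho0 Sinf.
have cr : c < c + rho by rewrite ltrDl.
have [r r0 rL] := lip_at_ball Tc cr.
exists (Num.min r rho), (c + rho), rho; split.
- by rewrite lt_min r0 rho0 ge_min lexx orbT.
- by rewrite addr_ge0// ltW.
- by rewrite rho0 ge_min lexx.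
split.
- exists T; move/lipschitzP : rL => rL; apply/lipschitzP => y z sy sz.
  by apply: rL; [apply: le_ball sy|apply: le_ball sz]; rewrite ge_min lexx.
- move=> a Aa; rewrite leNgt; apply/negP => sa; apply: sA (Aa).
  rewrite -ball_normE /=; apply: (lt_le_trans sa).
  have : rho <= d / 2 by rewrite ge_min lexx orbT.
  by lra.
- move=> T' c' c'0 Tc'; have : inf S <= c'.
    by apply: ge_inf; [case: Sinf|split => //; exists T'].
  by lra.
Qed.

(** If [x] lies in the ball of [s], then [rho s] and the distance from [s] to
    [a] are at most of the order of [`|x - a|]. When [x] is close to [a], the
    operator [G a] competes in the choice made at [s] and forces [kap s] to be
    small. Taking the errors of size [rho s ^+ 2] makes [g - F] of second order
    along [A]. *)
Lemma smooth_off_closed X Y (C : R) (O A : set X) (F : X -> Y)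
    (G : X -> lcfun X Y) :
  0 <= C -> ball_smoothing X Y C ->
  has_partitions_of_unity X ->
  (forall x, O x -> ~ A x -> \forall y \near x, ~ A y) ->
  (forall x, O x -> locally_lipschitz_at F x) ->
  (forall a, A a -> sdiff F a (G a)) ->
  exists g : X -> Y, [/\ forall x, (O `\` A) x -> sdiffable g x,
    forall x a, (O `\` A) x -> A a -> `|g x - F x| <= `|x - a| ^+ 2 &
    forall a e, A a -> 0 < e -> \forall x \near a, (O `\` A) x ->
      lip_at (g \- G a) x e].
Proof.
move=> C0 hS hP Acl FL FA.
have : forall s : X, exists r kap rho : R, (O `\` A) s ->
  [/\ 0 < r <= rho, 0 <= kap, 0 < rho <= 1 &
    [/\ exists T : lcfun X Y, kap.-lipschitz_(ball s r) (F \- T),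
    forall a, A a -> 2 * rho <= `|s - a| &
    forall (T : lcfun X Y) c, 0 <= c -> lip_at (F \- T) s c ->
      kap <= c + 2 * rho]].
  move=> s; have [[Os nAs]|nOs] := pselect ((O `\` A) s); last first.
    by exists 0, 0, 0.
  have [r [kap [rho H]]] := near_best_scale (FL _ Os) (Acl _ Os nAs).
  by exists r, kap, rho.
move=> /choice[r /choice[kap /choice[rho pP]]].
have dist s x a : (O `\` A) s -> ball s (r s) x -> A a ->
    rho s <= `|x - a| /\ `|s - a| <= 2 * `|x - a|.
  move=> Os sx Aa; have [/andP[_ rr] _ _ [_ /(_ a Aa) sa _]] := pP _ Os.
  move: sx; rewrite -ball_normE /= => sx; have := ler_distD x s a.
  by lra.
have [|g [gd gF gL]] := @smooth_approximation _ _ C (O `\` A) F r kap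
    (fun s => rho s ^+ 2) C0 hS hP.
  move=> s Os; have [/andP[r0 _] k0 /andP[rho0 _] [T _ _]] := pP _ Os.
  by split => //; rewrite exprn_gt0.
exists g; split => // [x a Ox Aa|a e Aa e0].
  apply: gF => // s Os sx; have [d1 _] := dist _ _ _ Os sx Aa.
  have [_ _ /andP[rho0 _] _] := pP _ Os.
  by rewrite ler_pXn2r// nnegrE// ltW.
(* with F - G a at scale e' and rho s <= e', the numbers kap s are at most
   e' + 2 * e'; then g - F contributes (C + 2) * (3 * e') and F - G a adds e' *)
pose e' := e / (3 * (C + 2) + 1).
have K0 : 0 < 3 * (C + 2) + 1 by rewrite ltr_wpDl// mulr_ge0// addr_ge0.
have e'0 : 0 < e' by rewrite divr_gt0.
have [d d0 FaL] := lip_at_ball (FA _ Aa) e'0.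
have d20 : 0 < d / 2 by rewrite divr_gt0.
have FG y : ball a d y -> lip_at (F \- G a) y e'.
  by move=> ay; apply: lipschitz_lip_at FaL; exact: ball_nbhs.
near=> x; move=> Ox.
have ax : ball a (d / 2) x by near: x; exact: nbhsx_ballx.
have xe : `|x - a| <= e'.
  rewrite distrC; suff : ball a e' x by rewrite -ball_normE /=; exact: ltW.
  by near: x; exact: nbhsx_ballx.
have h : lip_at (g \- F) x ((C + 2) * (3 * e')).
  apply: gL => // [|s Os sx]; first by rewrite mulr_ge0// ltW.
  have [d1 d2] := dist _ _ _ Os sx Aa.
  have [_ _ /andP[rho0 rho1] [_ _ kbest]] := pP _ Os.
  have as_ : ball a d s.
    by move: ax; rewrite -!ball_normE /= [`|a - x|]distrC [`|a - s|]distrC; lra.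
  have := kbest _ _ (ltW e'0) (FG _ as_).
  move=> kb; split; first by lra.
  rewrite expr2; nra.
have ax' : ball a d x by apply: le_ball ax; lra.
have := lip_atD h (FG _ ax').
rewrite (_ : _ + e' = e); last by rewrite /e'; field; rewrite gt_eqF.
apply: lip_at_near; apply: nearW => y /=.
by rewrite addrA subrK.
Unshelve. all: by end_near. Qed.

End SmoothApproximation.

Theorem theorem33 (R : realType) (X : normedModType R)
    (Y : completeNormedModType R)
    (hLE : property_LE X Y) (hLA1 : property_LA1 X Y)
    (Omega : set X) (hOmega : open Omega)
    (A : set X) (hAOmega : A `<=` Omega)
    (hAclosed : closed (A : set (subspace Omega)))
    (f : X -> Y) (G : X -> lcfun X Y) (hW : condition_W A f G) :
  exists g : X -> Y,
    [/\ C1_on Omega g,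
        forall x, A x -> g x = f x &
        forall x, A x -> 'd g x = G x :> (X -> Y)].
Proof.
(* the constructions below need a point of A and a nonzero vector of Y *)
have [A0|nA0] := pselect (A = set0).
  by exists (cst 0); split => [|x|x]; [exact: C1_on_cst0|rewrite A0..].
have [Y0|] := pselect (forall y : Y, y = 0).
  exists (cst 0); split => [|x _|x _]; first exact: C1_on_cst0.
    by rewrite (Y0 (f x)).
  by apply/funext => v; rewrite [LHS]Y0 [RHS]Y0.
move=> /existsNP[y0 /eqP y0n0].
have [C1 C10 hS] := ball_smoothing_LA1 hLA1.
have [C2 C20 hE] := hLE.
have hP : has_partitions_of_unity X.
  apply: (exists_partition_of_unity C10).
    exact: ball_smoothing_real y0n0 hS.
  exact: property_LE_real y0n0 hLE.
have Acl x : Omega x -> ~ A x -> \forall y \near x, ~ A y.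
  move=> Ox nAx.
  have : \forall y \near (x : subspace Omega), ~ A y.
    by apply: open_nbhs_nbhs; split => //; rewrite openC.
  move=> /(within_near Ox)[d d0 dA]; near=> y.
  by apply: dA; near: y; [exact: nbhsx_ballx|exact: open_nbhs_nbhs].
have [F [Ff FA FL]] := strict_extension (ltW C20) hE hP hAOmega Acl hW
  (proj1 (set0P A) (introN eqP nA0)).
have [g [gd gF gG]] := smooth_off_closed C10 hS hP Acl FL FA.
have /choice[T TP] : forall x : X, exists T : lcfun X Y,
    (Omega `\` A) x -> sdiff g x T.
  move=> x; have [/gd[T gT]|nOx] := pselect ((Omega `\` A) x).
    by exists T.
  by exists 0.
(* g approximates F off A only; its values at the points of A are arbitrary *)
pose h x := if `[< A x >] then f x else g x.
pose D x := if `[< A x >] then G x else T x.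
have OAx x : Omega x -> ~ A x -> \forall y \near x, (Omega `\` A) y.
  move=> Ox nAx; near=> y; split; near: y; last exact: Acl.
  by apply: open_nbhs_nbhs.
have hA a : A a -> h a = f a by move=> Aa; rewrite /h asboolT.
have hnA x : ~ A x -> h x = g x by move=> nAx; rewrite /h asboolF.
have DA x : A x -> D x = G x by move=> Ax; rewrite /D asboolT.
have DnA x : ~ A x -> D x = T x by move=> nAx; rewrite /D asboolF.
have Dh x : Omega x -> is_diff x h (D x).
  move=> Ox; have [Ax|nAx] := pselect (A x); last first.
    rewrite (DnA _ nAx); apply: sdiff_is_diff.
    apply: lip_at_near (TP _ (conj Ox nAx)).
    by apply: filterS (OAx _ Ox nAx) => y [_ nAy]; rewrite /= hnA.
  rewrite (DA _ Ax); apply: is_diff_eps => e e0.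
  have e20 : 0 < e / 2 by rewrite divr_gt0.
  have [d d0 /lipschitzP FxL] := lip_at_ball (FA _ Ax) e20.
  near=> y.
  have Oy : Omega y by near: y; exact: open_nbhs_nbhs.
  have xy : ball x d y by near: y; exact: nbhsx_ballx.
  have xy2 : `|y - x| <= e / 2.
    rewrite distrC.
    suff : ball x (e / 2) y by rewrite -ball_normE /=; exact: ltW.
    by near: y; exact: nbhsx_ballx.
  have hF : `|h y - F y| <= e / 2 * `|y - x|.
    have [Ay|nAy] := pselect (A y).
      by rewrite (hA _ Ay) Ff// subrr normr0 mulr_ge0// ltW.
    rewrite (hnA _ nAy); apply: le_trans (gF _ _ (conj Oy nAy) Ax) _.
    by rewrite expr2 ler_wpM2r.
  have FG : `|F y - F x - G x (y - x)| <= e / 2 * `|y - x|.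
    have := FxL _ _ xy (ballxx x d0).
    by rewrite /= (linearB (G x)) /= !opprD !opprK addrACA.
  rewrite (hA _ Ax) -(Ff _ Ax).
  have -> : h y - F x - G x (y - x) =
      (h y - F y) + (F y - F x - G x (y - x)).
    by rewrite !addrA subrK.
  by rewrite (le_trans (ler_normD _ _))// [e in leRHS]splitr mulrDl lerD.
exists h; split => //; last first.
  move=> x Ax; have := Dh _ (hAOmega _ Ax); rewrite (DA _ Ax) => hx.
  by case: hx.
exists D => //; rewrite continuous_open_subspace// => x; rewrite inE => Ox.
apply/cvgrPdist_le => e e0.
have [Ax|nAx] := pselect (A x); last first.
  have [d d0 gL] := lip_at_ball (TP _ (conj Ox nAx)) e0.
  near=> y; have [Oy nAy] : (Omega `\` A) y by near: y; exact: OAx.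
  rewrite (DnA _ nAx) (DnA _ nAy) distrC.
  apply: (sdiff_opnorm (ltW e0) (TP _ (conj Oy nAy))).
  apply: lipschitz_lip_at gL; apply: ball_nbhs.
  by near: y; exact: nbhsx_ballx.
have [Gc _] := hW.
have : \forall y \near (x : subspace A), opnorm (G x - G y) <= e.
  by have /cvgrPdist_le/(_ _ e0) := Gc x.
move=> /(within_near Ax)[d d0 GA].
near=> y; have Oy : Omega y by near: y; exact: open_nbhs_nbhs.
rewrite (DA _ Ax); have [Ay|nAy] := pselect (A y).
  by rewrite (DA _ Ay); apply: GA => //; near: y; exact: nbhsx_ballx.
rewrite (DnA _ nAy) distrC; apply: (sdiff_opnorm (ltW e0) (TP _ (conj Oy nAy))).
have : (Omega `\` A) y by []; near: y; exact: gG.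
Unshelve. all: by end_near. Qed.
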